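(* For each integer $j\ge 1$ let $M_j$ be the supremum of the $j$-th normalized Steklov eigenvalue $\tilde\sigma_j(g)$ over all $T>0$ and all rotationally symmetric conformal metrics $g=f(t)^2(dt^2+d\theta^2)$ on the cylinder $[0,T]\times\mathbb{S}^1$. Let $T_{2,0}(1)$ be the unique positive root of $s=\coth s$, and for each integer $k>1$ let $T_{k,1}(1)$ be the unique positive root of $k\tanh\left(\frac{ks}{2}\right)=\coth\left(\frac{s}{2}\right)$. Then: (1) For every integer $k\ge 1$, $$M_{2k-1}=\frac{4k\pi}{T_{2,0}(1)},$$ and it is achieved when and only when $f(0)=f(T)$ and $T=\frac{2}{k}T_{2,0}(1)$. (2) $M_2=4\pi$, and it is achieved when $f(0)=f(T)$ and $T=\infty$ (that is, in the limit: for metrics with $f(0)=f(T)$, $\tilde\sigma_2\to 4\pi$ as $T\to\infty$). (3) For every integer $k>1$, $$M_{2k}=4k\pi\tanh\left(\frac{kT_{k,1}(1)}{2}\right),$$ and it is achieved when and only when $f(0)=f(T)$ and $T=T_{k,1}(1)$.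
   Context: $\mathbb{S}^1=\mathbb{R}/2\pi\mathbb{Z}$ with coordinate $\theta$; $f>0$ is a smooth function on $[0,T]$. For a compact Riemannian surface $(M,g)$ with nonempty boundary, the Dirichlet-to-Neumann map $L_g$ sends $u\in C^\infty(\partial M)$ to $\partial\hat u/\partial n$, where $\hat u$ is the harmonic extension of $u$ to $M$ and $n$ is the unit outward normal on $\partial M$. Its eigenvalues, counted with multiplicity, $0=\sigma_0(g)<\sigma_1(g)\le\sigma_2(g)\le\cdots$, are the Steklov eigenvalues. The $k$-th normalized Steklov eigenvalue is $\tilde\sigma_k(g)=\sigma_k(g)L_g(\partial M)$, where $L_g(\partial M)$ is the length of $\partial M$. For $g=f(t)^2(dt^2+d\theta^2)$ on $[0,T]\times\mathbb{S}^1$, $\tilde\sigma_k(g)$ depends only on $f(0)/f(T)$ and $T$. *)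

(* Defs.v *)
From Stdlib Require Import Reals List ClassicalEpsilon.
From Coquelicot Require Export Coquelicot.
Import ListNotations.
Open Scope R_scope.

Definition smooth (h : R -> R) : Prop := forall n x, ex_derive_n h n x.

(* Smoothness on the closed interval, endpoints included: restriction of a
   smooth function on R.  Values of [h] outside [a, b] are irrelevant. *)
Definition smooth_on (a b : R) (h : R -> R) : Prop :=
  exists H, smooth H /\ forall t, a <= t <= b -> H t = h t.

Definition d_t (U : R -> R -> R) (t theta : R) : R :=
  Derive (fun s => U s theta) t.

Definition d_theta (U : R -> R -> R) (t theta : R) : R :=
  Derive (fun s => U t s) theta.

Fixpoint of_class_C (n : nat) (U : R -> R -> R) : Prop :=
  match n with
  | O => forall t theta, continuity_2d_pt U t theta
  | S m =>
      (forall t theta, ex_derive (fun s => U s theta) t /\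
                       ex_derive (fun s => U t s) theta) /\
      of_class_C m (d_t U) /\ of_class_C m (d_theta U)
  end.

Definition smooth2 (U : R -> R -> R) : Prop := forall n, of_class_C n U.

(* A function on S^1 = R / 2 pi Z is a 2 pi-periodic function on R. *)
Definition periodic (h : R -> R) : Prop :=
  forall theta, h (theta + 2 * PI) = h theta.

(* Components in the coordinates (t, theta) of
   g_tt dt^2 + 2 g_tz dt dtheta + g_zz dtheta^2. *)
Record metric := Metric {
  g_tt : R -> R -> R;
  g_tz : R -> R -> R;
  g_zz : R -> R -> R
}.

Definition vol (g : metric) (t theta : R) : R :=
  sqrt (g_tt g t theta * g_zz g t theta - g_tz g t theta ^ 2).

(* Components of the inverse matrix of g. *)
Definition inv_tt (g : metric) (t theta : R) : R :=
  g_zz g t theta / (vol g t theta) ^ 2.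
Definition inv_tz (g : metric) (t theta : R) : R :=
  - g_tz g t theta / (vol g t theta) ^ 2.
Definition inv_zz (g : metric) (t theta : R) : R :=
  g_tt g t theta / (vol g t theta) ^ 2.

Definition grad_t (g : metric) (U : R -> R -> R) (t theta : R) : R :=
  inv_tt g t theta * d_t U t theta + inv_tz g t theta * d_theta U t theta.
Definition grad_theta (g : metric) (U : R -> R -> R) (t theta : R) : R :=
  inv_tz g t theta * d_t U t theta + inv_zz g t theta * d_theta U t theta.

Definition laplacian (g : metric) (U : R -> R -> R) (t theta : R) : R :=
  / vol g t theta *
  (d_t (fun s z => vol g s z * grad_t g U s z) t theta +
   d_theta (fun s z => vol g s z * grad_theta g U s z) t theta).

Inductive boundary_circle := Left | Right.

Definition position (T : R) (b : boundary_circle) : R :=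
  match b with Left => 0 | Right => T end.

Definition outward_sign (b : boundary_circle) : R :=
  match b with Left => -1 | Right => 1 end.

(* The unit outward normal is n = grad t / |grad t| at t = T and its opposite
   at t = 0, with |grad t|^2 = g^tt; hence du/dn = +- du(grad t) / |grad t|. *)
Definition normal_derivative (g : metric) (T : R) (U : R -> R -> R)
    (b : boundary_circle) (theta : R) : R :=
  outward_sign b * grad_t g U (position T b) theta
    / sqrt (inv_tt g (position T b) theta).

Definition boundary_length (g : metric) (T : R) : R :=
  RInt (fun theta => sqrt (g_zz g 0 theta)) 0 (2 * PI) +
  RInt (fun theta => sqrt (g_zz g T theta)) 0 (2 * PI).

Definition boundary_function := boundary_circle -> R -> R.

Definition smooth_boundary_function (u : boundary_function) : Prop :=
  forall b, smooth (u b) /\ periodic (u b).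

(* [U] restricted to 0 <= t <= T is the harmonic extension of [u].  Smoothness
   up to the boundary means being the restriction of a smooth function on
   R x R; the values of [U] outside 0 <= t <= T affect neither this predicate
   nor [normal_derivative]. *)
Definition harmonic_extension (g : metric) (T : R) (u : boundary_function)
    (U : R -> R -> R) : Prop :=
  smooth2 U /\
  (forall t, 0 <= t <= T -> periodic (U t)) /\
  (forall t theta, 0 < t < T -> laplacian g U t theta = 0) /\
  (forall b theta, U (position T b) theta = u b theta).

Definition DN (g : metric) (T : R) (u v : boundary_function) : Prop :=
  exists U, harmonic_extension g T u U /\
    forall b theta, v b theta = normal_derivative g T U b theta.

Definition eigenspace (g : metric) (T lambda : R) (u : boundary_function)
    : Prop :=
  smooth_boundary_function u /\
  DN g T u (fun b theta => lambda * u b theta).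

Definition lin_comb (c : nat -> R) (e : nat -> boundary_function) (d : nat)
    : boundary_function :=
  fun b theta =>
    fold_right Rplus 0 (map (fun i => c i * e i b theta) (seq 0 d)).

Definition has_dimension (V : boundary_function -> Prop) (d : nat) : Prop :=
  exists e : nat -> boundary_function,
    (forall i, (i < d)%nat -> V (e i)) /\
    (forall c, (forall b theta, lin_comb c e d b theta = 0) ->
       forall i, (i < d)%nat -> c i = 0) /\
    (forall u, V u ->
       exists c, forall b theta, u b theta = lin_comb c e d b theta).

(* The eigenvalues in nondecreasing order, each real number [lambda] being
   listed as many times as the dimension of its eigenspace. *)
Definition is_steklov_spectrum (g : metric) (T : R) (sigma : nat -> R) : Prop :=
  (forall k, sigma k <= sigma (S k)) /\
  (forall lambda, exists l : list nat,
     NoDup l /\ (forall k, In k l <-> sigma k = lambda) /\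
     has_dimension (eigenspace g T lambda) (length l)).

Definition steklov (g : metric) (T : R) : nat -> R :=
  epsilon (inhabits (fun _ => 0)) (is_steklov_spectrum g T).

Definition normalized_steklov (g : metric) (T : R) (k : nat) : R :=
  steklov g T k * boundary_length g T.

Definition conformal_metric (f : R -> R) : metric :=
  Metric (fun t _ => f t ^ 2) (fun _ _ => 0) (fun t _ => f t ^ 2).

Definition conformal_factor (T : R) (f : R -> R) : Prop :=
  smooth_on 0 T f /\ forall t, 0 <= t <= T -> 0 < f t.

Definition sigma_tilde (f : R -> R) (T : R) (j : nat) : R :=
  normalized_steklov (conformal_metric f) T j.

Definition M (j : nat) : Rbar :=
  Lub_Rbar (fun x => exists (T : R) (f : R -> R),
    0 < T /\ conformal_factor T f /\ x = sigma_tilde f T j).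

Definition coth (x : R) : R := cosh x / sinh x.

(* Main.v *)
Require Import Defs.
From Stdlib Require Import ZArith Reals Lra Lia List FinFun.
From Stdlib Require Import Classical ClassicalEpsilon FunctionalExtensionality.
From Coquelicot Require Import Coquelicot.
Import ListNotations.
Open Scope R_scope.

(** Separation of variables turns the problem into an elementary one.  Put
    [kappa = 4 f(0) f(T) / (f(0) + f(T))^2], which lies in [(0, 1]] and equals [1]
    exactly when [f(0) = f(T)], and let [e_n(T) = n coth (n T)], with
    [e_0(T) = 1 / T].  A number [lambda] is an eigenvalue carried by
    [cos (n theta)] or [sin (n theta)] if and only if [x = lambda (f(0) + f(T))]
    solves [kappa x^2 / 4 - e_n(T) x + n^2 = 0], whose roots are written
    [x_n^-(kappa, T) < x_n^+(kappa, T)].  Frequency [0] contributes its two roots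
    once, and every positive frequency contributes each root twice.  The boundary
    has length [2 PI (f(0) + f(T))], so the normalised eigenvalues are [2 PI]
    times these roots in increasing order.  That there are no other
    eigenfunctions ([eigenspace_dimension]) comes from the completeness of the
    trigonometric system ([fourier_null_zero]) and from a Wronskian identity for
    the Fourier coefficients of the harmonic extension ([fourier_wronskian]).
    Bounds on the [j]-th eigenvalue are then statements about how many roots lie
    below a given level ([sorted_lt], [sorted_ge]).

    Parts (1) and (3) are one statement, [extremal_metric], with [m0 = 0] and
    [m0 = 1].  Let [Ts] be the length at which, for [kappa = 1], the root [x_k^-]
    equals [x_m0^+], and let [c] be this common value.  Unless [kappa = 1] and
    [T = Ts], there are at least [2 k + m0] roots below [c], counted with
    multiplicity.  For [T <= Ts] the roots [x_j^-] with [j <= k] suffice, because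
    [x_k^-] increases with [kappa] and with [T].  For [T > Ts] the frequencies
    are grouped in pairs [(n, m)] with [n + m = k + m0] and [m0 <= m < n], and each
    pair has [x_n^- < c] or [x_m^+ < c].  If both fail, subtracting the two
    characteristic polynomials at [c] gives
    [c (e_n - e_m) <= (n - m) (k + m0)].  At [T = Ts] the extreme pair [(k, m0)]
    satisfies this with equality, and [e_k - e_m0] increases strictly with the
    length ([radial_quotient_gap_increasing]).  It remains to see that
    [(e_n - e_m) / (n - m)] is smallest for the extreme pair.  This is
    [pairing_inequality], which rests on the identity
    [y coth y - z coth z = s d (shc s - shc d) / (cosh s - cosh d)] with
    [s = y + z], [d = y - z] and [shc x = sinh x / x], and on the fact that
    [shc' / cosh'] decreases.

    For part (2) the second eigenvalue is at most [2 PI x_1^-], which is less than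
    [4 PI]; when [f(0) = f(T)] it equals [4 PI tanh (T / 2)]. *)

(** * Finite sums and dimension *)

Definition lsum {A : Type} (l : list A) (F : A -> R) : R :=
  fold_right Rplus 0 (map F l).

Lemma lsum_cons {A} (a : A) l F : lsum (a :: l) F = F a + lsum l F.
Proof. reflexivity. Qed.

Lemma lsum_app {A} (l1 l2 : list A) F :
  lsum (l1 ++ l2) F = lsum l1 F + lsum l2 F.
Proof.
  induction l1 as [|a l1 IH]; [unfold lsum; simpl; lra|].
  simpl app; rewrite !lsum_cons, IH; lra.
Qed.

Lemma lsum_ext {A} (l : list A) F G :
  (forall a, In a l -> F a = G a) -> lsum l F = lsum l G.
Proof. intros H; unfold lsum; f_equal; now apply map_ext_in. Qed.

Lemma lsum_zero {A} (l : list A) F : (forall a, In a l -> F a = 0) -> lsum l F = 0.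
Proof.
  induction l as [|a l IH]; intros H; [reflexivity|].
  rewrite lsum_cons, (H a), IH; [lra| |now left].
  intros b Hb; apply H; now right.
Qed.

Lemma lsum_plus {A} (l : list A) F G :
  lsum l (fun a => F a + G a) = lsum l F + lsum l G.
Proof.
  induction l as [|a l IH]; [unfold lsum; simpl; lra|].
  rewrite !lsum_cons, IH; lra.
Qed.

Lemma lsum_scal {A} (l : list A) (r : R) F :
  lsum l (fun a => r * F a) = r * lsum l F.
Proof.
  induction l as [|a l IH]; [unfold lsum; simpl; lra|].
  rewrite !lsum_cons, IH; lra.
Qed.

Lemma lsum_single {A} (l : list A) F a :
  NoDup l -> In a l -> (forall b, In b l -> b <> a -> F b = 0) -> lsum l F = F a.
Proof.
  intros Hl Ha H; destruct (in_split _ _ Ha) as (l1 & l2 & ->).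
  apply NoDup_remove_2 in Hl.
  rewrite lsum_app, lsum_cons, (lsum_zero l1), (lsum_zero l2); try lra;
    intros b Hb; (apply H; [apply in_or_app; simpl; tauto|]);
    intros ->; apply Hl, in_or_app; tauto.
Qed.

Lemma lsum_swap {A B} (l : list A) (l' : list B) (F : A -> B -> R) :
  lsum l (fun a => lsum l' (fun b => F a b)) =
  lsum l' (fun b => lsum l (fun a => F a b)).
Proof.
  induction l as [|a l IH].
  - symmetry; now apply lsum_zero.
  - rewrite lsum_cons, IH, <- lsum_plus; apply lsum_ext; intros b _.
    now rewrite lsum_cons.
Qed.

(** Gaussian elimination: the last equation either is void on the unknowns of
    [l], or has a pivot [p], through which it is eliminated together with the
    unknown [p]. *)
Lemma homogeneous_system {A : Type} (d : nat) :
  forall (l : list A) (g : nat -> A -> R),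
    NoDup l -> (d < length l)%nat ->
    exists c : A -> R, (exists a, In a l /\ c a <> 0) /\
      forall j, (j < d)%nat -> lsum l (fun a => c a * g j a) = 0.
Proof.
  induction d as [|d IH]; intros l g Hnd Hlen.
  - destruct l as [|a l]; [simpl in Hlen; lia|].
    exists (fun _ => 1); split; [exists a; split; [now left|lra]|lia].
  - destruct (classic (exists p, In p l /\ g d p <> 0)) as [(p & Hp & Hpiv)|Hno].
    + destruct (in_split _ _ Hp) as (l1 & l2 & ->).
      pose proof (NoDup_remove_1 _ _ _ Hnd) as Hnd'.
      pose proof (NoDup_remove_2 _ _ _ Hnd) as Hnotin.
      destruct (IH (l1 ++ l2) (fun j a => g j a - g d a / g d p * g j p)) as
        (c & (a & Ha & Hca) & Hc); auto.
      { rewrite length_app in *; simpl in Hlen; lia. }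
      set (cp := - lsum (l1 ++ l2) (fun b => c b * g d b) / g d p).
      pose (c' := fun b => if excluded_middle_informative (b = p) then cp else c b).
      assert (Hc' : forall b, In b (l1 ++ l2) -> c' b = c b).
      { intros b Hb; unfold c'; destruct (excluded_middle_informative (b = p));
          [subst; contradiction|reflexivity]. }
      assert (Hc'p : c' p = cp).
      { unfold c'; destruct (excluded_middle_informative (p = p)); tauto. }
      exists c'; split.
      * exists a; split; [|now rewrite Hc'].
        apply in_app_or in Ha; apply in_or_app; simpl; tauto.
      * intros j Hj.
        assert (E : lsum (l1 ++ p :: l2) (fun b => c' b * g j b) =
                    lsum (l1 ++ l2) (fun b => c b * g j b) + cp * g j p).
        { rewrite !lsum_app, lsum_cons, Hc'p.
          rewrite (lsum_ext l1 (fun b => c' b * g j b) (fun b => c b * g j b)),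
                  (lsum_ext l2 (fun b => c' b * g j b) (fun b => c b * g j b));
            [lra| |]; intros b Hb; rewrite Hc'; auto; apply in_or_app; tauto. }
        rewrite E; clear E.
        destruct (Nat.eq_dec j d) as [->|Hjd].
        { unfold cp; field; auto. }
        specialize (Hc j ltac:(lia)).
        rewrite (lsum_ext _ _ (fun b => c b * g j b + (- (g j p / g d p)) * (c b * g d b)))
          in Hc by (intros; field; auto).
        rewrite lsum_plus, lsum_scal in Hc.
        rewrite <- Hc; unfold cp; field; auto.
    + destruct (IH l g) as (c & Hc0 & Hc); auto; [lia|].
      exists c; split; auto; intros j Hj.
      destruct (Nat.eq_dec j d) as [->|Hjd]; [|apply Hc; lia].
      apply lsum_zero; intros a Ha.
      destruct (Req_dec (g d a) 0) as [->|Hg]; [lra|].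
      exfalso; apply Hno; eauto.
Qed.

Lemma choice_function {A B : Type} (P : A -> B -> Prop) :
  (forall a, exists b, P a b) -> exists h : A -> B, forall a, P a (h a).
Proof.
  intros H; exists (fun a => proj1_sig (constructive_indefinite_description _ (H a))).
  intros a; apply proj2_sig.
Qed.

Lemma lin_comb_lsum c e d b theta :
  lin_comb c e d b theta = lsum (seq 0 d) (fun i => c i * e i b theta).
Proof. reflexivity. Qed.

Lemma has_dimension_le V d d' :
  has_dimension V d -> has_dimension V d' -> (d <= d')%nat.
Proof.
  intros (e & HV & Hfree & _) (e' & _ & _ & Hspan).
  destruct (Nat.le_gt_cases d d') as [|Hlt]; auto; exfalso.
  assert (Hm : forall i, exists m : nat -> R, (i < d)%nat ->
            forall b theta, e i b theta = lin_comb m e' d' b theta).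
  { intros i; destruct (Nat.lt_ge_cases i d) as [Hi|Hi].
    - destruct (Hspan _ (HV i Hi)) as (m & Hm); now exists m.
    - exists (fun _ => 0); lia. }
  apply choice_function in Hm; destruct Hm as (m & Hm).
  destruct (homogeneous_system d' (seq 0 d) (fun j i => m i j)) as
    (c & (i & Hi & Hci) & Hc).
  { apply seq_NoDup. }
  { now rewrite length_seq. }
  apply in_seq in Hi.
  apply Hci, Hfree; [|lia]; intros b theta.
  rewrite lin_comb_lsum.
  rewrite (lsum_ext _ _ (fun i => lsum (seq 0 d') (fun j => c i * m i j * e' j b theta))).
  - rewrite lsum_swap; apply lsum_zero; intros j Hj; apply in_seq in Hj.
    rewrite (lsum_ext _ _ (fun i => e' j b theta * (c i * m i j))) by (intros; ring).
    rewrite lsum_scal, (Hc j) by lia; ring.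
  - intros i' Hi'; apply in_seq in Hi'.
    rewrite Hm by lia; rewrite lin_comb_lsum, <- lsum_scal.
    apply lsum_ext; intros; ring.
Qed.

Lemma has_dimension_unique V d d' :
  has_dimension V d -> has_dimension V d' -> d = d'.
Proof. intros H H'; apply Nat.le_antisymm; eapply has_dimension_le; eauto. Qed.

(** * Sorting and counting locally finite families of reals *)

(** Stated level by level, since the multiplicity of an eigenvalue is only known
    as the dimension of its eigenspace; it amounts to a bijection compatible with
    [u] and [v]. *)
Definition same_multiplicities {A B : Type} (u : A -> R) (v : B -> R) : Prop :=
  forall lambda, exists (la : list A) (lb : list B),
    NoDup la /\ NoDup lb /\ length la = length lb /\
    (forall a, In a la <-> u a = lambda) /\ (forall b, In b lb <-> v b = lambda).

Lemma same_multiplicities_sym {A B} (u : A -> R) (v : B -> R) :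
  same_multiplicities u v -> same_multiplicities v u.
Proof.
  intros H lambda; destruct (H lambda) as (la & lb & ?).
  exists lb, la; intuition.
Qed.

(** On each level set, match the entries of the two lists in order. *)
Lemma same_multiplicities_injection {A B} (u : A -> R) (v : B -> R) :
  same_multiplicities u v ->
  exists beta : A -> B,
    (forall a a', beta a = beta a' -> a = a') /\ forall a, v (beta a) = u a.
Proof.
  intros H; apply choice_function in H; destruct H as (la & H).
  apply choice_function in H; destruct H as (lb & H).
  assert (Hex : forall a, exists b, exists i,
            nth_error (la (u a)) i = Some a /\ nth_error (lb (u a)) i = Some b).
  { intros a; destruct (H (u a)) as (_ & _ & Hlen & Hla & _).
    destruct (In_nth_error (la (u a)) a) as (i & Hi); [now apply Hla|].
    destruct (nth_error (lb (u a)) i) as [b|] eqn:Eb; [eauto|].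
    apply nth_error_None in Eb; rewrite <- Hlen in Eb.
    apply nth_error_None in Eb; congruence. }
  apply choice_function in Hex; destruct Hex as (beta & Hbeta).
  assert (Hv : forall a, v (beta a) = u a).
  { intros a; destruct (Hbeta a) as (i & _ & Hi).
    apply (H (u a)); now apply nth_error_In with i. }
  exists beta; split; auto.
  intros a a' E; assert (Eu : u a = u a') by now rewrite <- !Hv, E.
  destruct (Hbeta a) as (i & Hi & Hbi), (Hbeta a') as (i' & Hi' & Hbi').
  rewrite <- E, <- Eu in Hbi'; rewrite <- Eu in Hi'.
  destruct (H (u a)) as (_ & Hnd & _).
  assert (i = i').
  { apply (proj1 (NoDup_nth_error _) Hnd); [|congruence].
    apply nth_error_Some; congruence. }
  subst; congruence.
Qed.

Lemma NoDup_map_injective {A B} (h : A -> B) l :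
  (forall a a', h a = h a' -> a = a') -> NoDup l -> NoDup (map h l).
Proof. intros; now apply Injective_map_NoDup. Qed.

Lemma nondecreasing_le (sigma : nat -> R) :
  (forall k, sigma k <= sigma (S k)) ->
  forall i j, (i <= j)%nat -> sigma i <= sigma j.
Proof.
  intros H i j Hij; induction Hij; [lra|]; eapply Rle_trans; eauto.
Qed.

(** The labels in [l] inject into the indices of [sigma] whose value is below
    [c]; if [N] were not among these indices, all of them would be below [N]. *)
Lemma sorted_lt {A} (u : A -> R) (sigma : nat -> R) (c : R) (l : list A) (N : nat) :
  same_multiplicities u sigma -> (forall k, sigma k <= sigma (S k)) ->
  NoDup l -> (N < length l)%nat -> (forall a, In a l -> u a < c) -> sigma N < c.
Proof.
  intros Hm Hs Hnd Hlen Hl.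
  destruct (same_multiplicities_injection _ _ Hm) as (beta & Hinj & Hb).
  destruct (Rlt_le_dec (sigma N) c) as [|Hc]; auto; exfalso.
  assert (Hle : (length (map beta l) <= length (seq 0 N))%nat).
  { apply NoDup_incl_length; [now apply NoDup_map_injective|].
    intros k Hk; apply in_map_iff in Hk; destruct Hk as (a & <- & Ha).
    apply in_seq; split; [lia|]; simpl.
    destruct (Nat.lt_ge_cases (beta a) N) as [|Hge]; auto.
    pose proof (nondecreasing_le _ Hs _ _ Hge); specialize (Hl a Ha).
    rewrite Hb in *; lra. }
  rewrite length_map, length_seq in Hle; lia.
Qed.

Lemma sorted_le {A} (u : A -> R) (sigma : nat -> R) (c : R) (l : list A) (N : nat) :
  same_multiplicities u sigma -> (forall k, sigma k <= sigma (S k)) ->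
  NoDup l -> (N < length l)%nat -> (forall a, In a l -> u a <= c) -> sigma N <= c.
Proof.
  intros Hm Hs Hnd Hlen Hl; apply le_epsilon; intros eps Heps; left.
  apply (sorted_lt u sigma (c + eps) l N); auto.
  intros a Ha; specialize (Hl a Ha); lra.
Qed.

(** Conversely, if the value at [N] were below [c], so would be the first [N + 1]
    values, and these inject into [l]. *)
Lemma sorted_ge {A} (u : A -> R) (sigma : nat -> R) (c : R) (l : list A) (N : nat) :
  same_multiplicities u sigma -> (forall k, sigma k <= sigma (S k)) ->
  (length l <= N)%nat -> (forall a, u a < c -> In a l) -> c <= sigma N.
Proof.
  intros Hm Hs Hlen Hl.
  destruct (same_multiplicities_injection _ _ (same_multiplicities_sym _ _ Hm))
    as (alpha & Hinj & Ha).
  destruct (Rlt_le_dec (sigma N) c) as [Hc|]; auto; exfalso.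
  assert (Hle : (length (map alpha (seq 0 (S N))) <= length l)%nat).
  { apply NoDup_incl_length; [apply NoDup_map_injective, seq_NoDup; auto|].
    intros a Hk; apply in_map_iff in Hk; destruct Hk as (k & <- & Hk).
    apply in_seq in Hk; apply Hl; rewrite Ha.
    eapply Rle_lt_trans; [apply (nondecreasing_le _ Hs k N); lia|auto]. }
  rewrite length_map, length_seq in Hle; lia.
Qed.

Lemma min_over_list {A} (u : A -> R) (P : A -> Prop) (l : list A) :
  (exists a, In a l /\ P a) ->
  exists a, In a l /\ P a /\ forall b, In b l -> P b -> u a <= u b.
Proof.
  induction l as [|x l IH]; intros (a & Ha & HPa); [destruct Ha|].
  destruct (classic (exists a, In a l /\ P a)) as [Hl|Hno].
  - destruct (IH Hl) as (m & Hm & HPm & Hmin).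
    destruct (classic (P x /\ u x < u m)) as [[HPx Hx]|Hx].
    + exists x; split; [now left|]; split; auto.
      intros b [<-|Hb] HPb; [lra|]; specialize (Hmin b Hb HPb); lra.
    + exists m; split; [now right|]; split; auto.
      intros b [<-|Hb] HPb; auto.
      apply Rnot_lt_le; intros Hlt; tauto.
  - exists a; split; auto; split; auto; intros b Hb HPb.
    destruct Ha as [<-|Ha]; [|exfalso; eauto].
    destruct Hb as [<-|Hb]; [lra|exfalso; eauto].
Qed.

Lemma exists_sublist {A} (l : list A) (P : A -> Prop) :
  exists l', NoDup l' /\ forall a, In a l' <-> In a l /\ P a.
Proof.
  induction l as [|x l (l' & Hnd & Hl')].
  - exists []; split; [constructor|simpl; tauto].
  - destruct (classic (P x /\ ~ In x l')) as [[Hx Hn]|Hx].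
    + exists (x :: l'); split; [now constructor|].
      intros a; simpl; rewrite Hl'; split; [intros [<-|]; tauto|tauto].
    + exists l'; split; auto; intros a; rewrite Hl'; simpl.
      split; [tauto|]; intros [[<-|Ha] HP]; [|tauto].
      apply Hl', NNPP; tauto.
Qed.

(** Repeatedly extract a smallest value among the labels not yet listed.  A
    label that is never extracted would bound all the extracted values. *)
Lemma sorted_enumeration {A} (u : A -> R) :
  (forall l : list A, exists a, ~ In a l) ->
  (forall c, exists l, forall a, u a <= c -> In a l) ->
  exists sigma : nat -> R,
    (forall k, sigma k <= sigma (S k)) /\ same_multiplicities u sigma.
Proof.
  intros Hinf Hfin.
  assert (Hnext : forall l : list A, exists a, ~ In a l /\
                    forall b, ~ In b l -> u a <= u b).
  { intros l; destruct (Hinf l) as (a0 & Ha0), (Hfin (u a0)) as (F & HF).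
    destruct (min_over_list u (fun a => ~ In a l) F) as (a & _ & Ha & Hmin).
    { exists a0; split; auto; apply HF; lra. }
    exists a; split; auto; intros b Hb.
    destruct (Rle_lt_dec (u b) (u a0)) as [Hle|Hlt]; auto.
    specialize (Hmin a0 (HF a0 (Rle_refl _)) Ha0); lra. }
  apply choice_function in Hnext; destruct Hnext as (next & Hnext).
  pose (used := fix used n := match n with
                | O => [] | S n => next (used n) :: used n end).
  pose (s := fun n => next (used n)).
  assert (Hused : forall n i, (i < n)%nat -> In (s i) (used n)).
  { induction n as [|n IH]; intros i Hi; [lia|]; simpl.
    destruct (Nat.eq_dec i n) as [->|]; [now left|right; apply IH; lia]. }
  assert (Hs : forall k, u (s k) <= u (s (S k))).
  { intros k; apply Hnext; intros HI.
    destruct (Hnext (used (S k))) as [Hn _]; apply Hn; now right. }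
  assert (Hneq : forall i j, (i < j)%nat -> s i <> s j).
  { intros i j Hij E; destruct (Hnext (used j)) as [Hn _]; apply Hn.
    change (In (s j) (used j)); rewrite <- E; now apply Hused. }
  assert (Hinj : forall i j, s i = s j -> i = j).
  { intros i j E; destruct (Nat.lt_trichotomy i j) as [Hij|[|Hij]]; auto; exfalso.
    - now apply (Hneq i j).
    - now apply (Hneq j i). }
  assert (Hsurj : forall a, exists k, s k = a).
  { intros a; apply NNPP; intros Hno.
    assert (Hn : forall n, ~ In a (used n)).
    { induction n as [|n IH]; [simpl; tauto|]; intros [E|HI]; [|tauto].
      apply Hno; now exists n. }
    destruct (Hfin (u a)) as (F & HF).
    assert (Hle : (length (map s (seq 0 (S (length F)))) <= length F)%nat).
    { apply NoDup_incl_length; [apply NoDup_map_injective, seq_NoDup; auto|].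
      intros b Hb; apply in_map_iff in Hb; destruct Hb as (k & <- & _).
      apply HF, Hnext, Hn. }
    rewrite length_map, length_seq in Hle; lia. }
  exists (fun k => u (s k)); split; auto.
  apply choice_function in Hsurj; destruct Hsurj as (r & Hr).
  intros lambda; destruct (Hfin lambda) as (F & HF).
  destruct (exists_sublist F (fun a => u a = lambda)) as (l & Hnd & Hl).
  exists l, (map r l); rewrite length_map.
  assert (Hl' : forall a, In a l <-> u a = lambda).
  { intros a; rewrite Hl; split; [tauto|]; intros E; split; auto; apply HF; lra. }
  repeat split; auto.
  - apply NoDup_map_injective; auto.
    intros a a' E; now rewrite <- (Hr a), <- (Hr a'), E.
  - apply Hl'.
  - apply Hl'.
  - rewrite in_map_iff; intros (a & <- & Ha); rewrite Hr; now apply Hl'.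
  - intros E; apply in_map_iff; exists (s b); split; [|now apply Hl'].
    apply Hinj, Hr.
Qed.

(** * Calculus on the line *)

Definition continuous_fun (h : R -> R) : Prop := forall x, continuous h x.

Lemma continuous_fun_derivable h : (forall x, ex_derive h x) -> continuous_fun h.
Proof. intros H x; now apply (ex_derive_continuous (K := R_AbsRing) (V := R_NormedModule)). Qed.

Lemma continuous_fun_plus h g :
  continuous_fun h -> continuous_fun g -> continuous_fun (fun x => h x + g x).
Proof. intros Hh Hg x; now apply (continuous_plus (V := R_NormedModule)). Qed.

Lemma continuous_fun_mult h g :
  continuous_fun h -> continuous_fun g -> continuous_fun (fun x => h x * g x).
Proof. intros Hh Hg x; now apply (continuous_mult (K := R_AbsRing)). Qed.

Lemma continuous_fun_const c : continuous_fun (fun _ => c).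
Proof. intros x; apply continuous_const. Qed.

Lemma continuous_fun_Rabs h : continuous_fun h -> continuous_fun (fun x => Rabs (h x)).
Proof. intros Hh x; now apply (continuous_comp h Rabs); [|apply continuous_Rabs]. Qed.

Lemma continuous_fun_lsum {A} (l : list A) (c : A -> R) (h : A -> R -> R) :
  (forall a, continuous_fun (h a)) ->
  continuous_fun (fun x => lsum l (fun a => c a * h a x)).
Proof.
  intros H; induction l as [|a l IH]; [exact (continuous_fun_const 0)|].
  apply (continuous_fun_plus (fun x => c a * h a x)); auto.
  apply continuous_fun_mult; auto; apply continuous_fun_const.
Qed.

Lemma ex_RInt_continuous_fun h a b : continuous_fun h -> ex_RInt h a b.
Proof. intros Hh; apply (ex_RInt_continuous (V := R_CompleteNormedModule)); auto. Qed.

Lemma RInt_pointwise (h g : R -> R) a b :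
  (forall x, h x = g x) -> RInt h a b = RInt g a b.
Proof. intros E; apply RInt_ext; intros; apply E. Qed.

Lemma RInt_linear h g a b r s :
  continuous_fun h -> continuous_fun g ->
  RInt (fun x => r * h x + s * g x) a b = r * RInt h a b + s * RInt g a b.
Proof.
  intros Hh Hg; apply is_RInt_unique.
  apply (is_RInt_plus (V := R_NormedModule) (fun x => r * h x) (fun x => s * g x));
    apply (is_RInt_scal (V := R_NormedModule));
    now apply (RInt_correct (V := R_CompleteNormedModule)), ex_RInt_continuous_fun.
Qed.

Lemma RInt_derivative F f a b :
  (forall x, is_derive F x (f x)) -> continuous_fun f -> RInt f a b = F b - F a.
Proof. intros HF Hf; apply is_RInt_unique, (is_RInt_derive (V := R_CompleteNormedModule)); auto. Qed.

Lemma is_derive_value (h : R -> R) (x l l' : R) :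
  is_derive h x l -> l = l' -> is_derive h x l'.
Proof. now intros H <-. Qed.

Lemma is_derive_prod (h k : R -> R) (x h' k' : R) :
  is_derive h x h' -> is_derive k x k' ->
  is_derive (fun y => h y * k y) x (h' * k x + h x * k').
Proof.
  intros Hh Hk; apply (is_derive_mult (K := R_AbsRing) h k); auto.
  intros; apply Rmult_comm.
Qed.

Lemma is_derive_diff (h k : R -> R) (x h' k' : R) :
  is_derive h x h' -> is_derive k x k' ->
  is_derive (fun y => h y - k y) x (h' - k').
Proof. intros Hh Hk; now apply (is_derive_minus (K := R_AbsRing) (V := R_NormedModule)). Qed.

Lemma is_derive_sum (h k : R -> R) (x h' k' : R) :
  is_derive h x h' -> is_derive k x k' ->
  is_derive (fun y => h y + k y) x (h' + k').
Proof. intros Hh Hk; now apply (is_derive_plus (K := R_AbsRing) (V := R_NormedModule)). Qed.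

Lemma is_derive_affine (h : R -> R) (a b x h' : R) :
  is_derive h (a + b * x) h' -> is_derive (fun y => h (a + b * y)) x (b * h').
Proof.
  intros Hh; apply (is_derive_comp h (fun y => a + b * y)); auto.
  apply (is_derive_value _ _ (0 + b * 1)); [|ring].
  apply (is_derive_sum (fun _ => a)); [apply (is_derive_const (K := R_AbsRing) (V := R_NormedModule))|].
  apply (is_derive_scal (fun y => y)), (is_derive_id (K := R_AbsRing)).
Qed.

Lemma mean_value (F f : R -> R) a b :
  a < b -> (forall x, a <= x <= b -> is_derive F x (f x)) ->
  exists c, a < c < b /\ F b - F a = f c * (b - a).
Proof.
  intros Hab HF; destruct (MVT_cor2 F f a b Hab) as (c & E & Hc); eauto.
  intros x Hx; now apply is_derive_Reals, HF.
Qed.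

Lemma increment_nonneg (F f : R -> R) a b :
  a <= b -> (forall x, a <= x <= b -> is_derive F x (f x)) ->
  (forall x, a < x < b -> 0 <= f x) -> F a <= F b.
Proof.
  intros [Hab| ->] HF Hf; [|lra].
  destruct (mean_value F f a b) as (c & Hc & E); auto.
  specialize (Hf c Hc); nra.
Qed.

Lemma increment_pos (F f : R -> R) a b :
  a < b -> (forall x, a <= x <= b -> is_derive F x (f x)) ->
  (forall x, a < x < b -> 0 < f x) -> F a < F b.
Proof.
  intros Hab HF Hf.
  destruct (mean_value F f a b) as (c & Hc & E); auto.
  specialize (Hf c Hc); nra.
Qed.

(** * Fourier coefficients of periodic functions *)

Definition trig (n : nat) (q : bool) (theta : R) : R :=
  if q then cos (INR n * theta) else sin (INR n * theta).

Definition trig' (n : nat) (q : bool) (theta : R) : R :=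
  if q then - INR n * sin (INR n * theta) else INR n * cos (INR n * theta).

Lemma is_derive_trig n q theta : is_derive (trig n q) theta (trig' n q theta).
Proof. destruct q; unfold trig, trig'; auto_derive; auto; ring. Qed.

Lemma is_derive_trig' n q theta :
  is_derive (trig' n q) theta (- INR n ^ 2 * trig n q theta).
Proof. destruct q; unfold trig, trig'; auto_derive; auto; ring. Qed.

Lemma continuous_trig n q : continuous_fun (trig n q).
Proof. apply continuous_fun_derivable; intros x; eexists; apply is_derive_trig. Qed.

Lemma trig_periodic n q : periodic (trig n q).
Proof.
  intros theta; unfold trig.
  replace (INR n * (theta + 2 * PI)) with (INR n * theta + 2 * INR n * PI) by ring.
  destruct q; [apply cos_period|apply sin_period].
Qed.

Lemma trig'_periodic n q : periodic (trig' n q).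
Proof.
  intros theta; unfold trig'.
  replace (INR n * (theta + 2 * PI)) with (INR n * theta + 2 * INR n * PI) by ring.
  destruct q; f_equal; [apply sin_period|apply cos_period].
Qed.

Definition fourier (h : R -> R) (n : nat) (q : bool) : R :=
  RInt (fun theta => h theta * trig n q theta) 0 (2 * PI).

Lemma fourier_linear h g r s n q :
  continuous_fun h -> continuous_fun g ->
  fourier (fun x => r * h x + s * g x) n q = r * fourier h n q + s * fourier g n q.
Proof.
  intros Hh Hg; unfold fourier; rewrite <- RInt_linear;
    try (apply continuous_fun_mult; auto; apply continuous_trig).
  apply RInt_pointwise; intros; ring.
Qed.

Lemma fourier_lsum {A} (l : list A) (c : A -> R) (h : A -> R -> R) n q :
  (forall a, continuous_fun (h a)) ->
  fourier (fun x => lsum l (fun a => c a * h a x)) n q =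
  lsum l (fun a => c a * fourier (h a) n q).
Proof.
  intros H; induction l as [|a l IH].
  - unfold fourier, lsum; simpl.
    rewrite (RInt_pointwise _ (fun _ => 0)) by (intros; ring).
    rewrite RInt_const; apply Rmult_0_r.
  - rewrite lsum_cons, <- IH.
    replace (c a * fourier (h a) n q +
             fourier (fun x => lsum l (fun a => c a * h a x)) n q)
      with (c a * fourier (h a) n q +
             1 * fourier (fun x => lsum l (fun a => c a * h a x)) n q) by ring.
    rewrite <- fourier_linear by auto using continuous_fun_lsum.
    unfold fourier; apply RInt_pointwise; intros; rewrite lsum_cons; ring.
Qed.

Lemma fourier_scal h r n q : fourier h n q = 0 -> continuous_fun h ->
  fourier (fun x => r * h x) n q = 0.
Proof.
  intros E Hh.
  transitivity (fourier (fun x => r * h x + 0 * h x) n q).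
  - unfold fourier; apply RInt_pointwise; intros; ring.
  - rewrite fourier_linear, E by auto; ring.
Qed.

(** ** Completeness of the trigonometric system *)

Definition fourier_null (h : R -> R) : Prop :=
  continuous_fun h /\ forall n q, fourier h n q = 0.

(** Multipliers that preserve the vanishing of all Fourier coefficients; by the
    product formulas they contain the trigonometric polynomials. *)
Definition null_multiplier (m : R -> R) : Prop :=
  forall h, fourier_null h -> fourier_null (fun x => h x * m x).

Lemma null_multiplier_trig_products m :
  continuous_fun m ->
  (forall n q, exists r n1 s n2 q', forall x,
     m x * trig n q x = r * trig n1 q' x + s * trig n2 q' x) ->
  null_multiplier m.
Proof.
  intros Hm H h [Hh H0]; split; [now apply continuous_fun_mult|].
  intros n q; destruct (H n q) as (r & n1 & s & n2 & q' & E).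
  unfold fourier.
  rewrite (RInt_pointwise _ (fun x => r * (h x * trig n1 q' x) + s * (h x * trig n2 q' x))).
  - rewrite RInt_linear; try (apply continuous_fun_mult; auto; apply continuous_trig).
    fold (fourier h n1 q') (fourier h n2 q'); rewrite !H0; ring.
  - intros x; rewrite Rmult_assoc, E; ring.
Qed.

Lemma null_multiplier_cos : null_multiplier cos.
Proof.
  apply null_multiplier_trig_products; [apply continuous_fun_derivable; intros x; auto_derive; auto|].
  intros [|n] q.
  - exists (if q then 1 else 0), 1%nat, 0, 0%nat, q; intros x; unfold trig; simpl.
    destruct q; rewrite ?Rmult_0_l, ?Rmult_1_l, ?sin_0, ?cos_0; ring.
  - exists (/ 2), (S (S n)), (/ 2), n, q; intros x; unfold trig.
    rewrite !S_INR.
    replace ((INR n + 1 + 1) * x) with ((INR n + 1) * x + x) by ring.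
    replace (INR n * x) with ((INR n + 1) * x - x) by ring.
    destruct q; rewrite ?cos_plus, ?cos_minus, ?sin_plus, ?sin_minus; field.
Qed.

Lemma null_multiplier_sin : null_multiplier sin.
Proof.
  apply null_multiplier_trig_products; [apply continuous_fun_derivable; intros x; auto_derive; auto|].
  intros [|n] q.
  - exists (if q then 1 else 0), 1%nat, 0, 0%nat, (negb q); intros x; unfold trig; simpl.
    destruct q; simpl; rewrite ?Rmult_0_l, ?Rmult_1_l, ?sin_0, ?cos_0; ring.
  - exists (if q then / 2 else - / 2), (S (S n)), (if q then - / 2 else / 2), n, (negb q).
    intros x; unfold trig; rewrite !S_INR.
    replace ((INR n + 1 + 1) * x) with ((INR n + 1) * x + x) by ring.
    replace (INR n * x) with ((INR n + 1) * x - x) by ring.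
    destruct q; simpl; rewrite ?cos_plus, ?cos_minus, ?sin_plus, ?sin_minus; field.
Qed.

Lemma null_multiplier_linear m1 m2 r s :
  null_multiplier m1 -> null_multiplier m2 ->
  null_multiplier (fun x => r * m1 x + s * m2 x).
Proof.
  intros H1 H2 h Hh; destruct (H1 h Hh) as [C1 E1], (H2 h Hh) as [C2 E2].
  assert (E : (fun x => h x * (r * m1 x + s * m2 x)) =
              (fun x => r * (h x * m1 x) + s * (h x * m2 x)))
    by (apply functional_extensionality; intros; ring).
  rewrite E; split.
  - apply continuous_fun_plus; apply continuous_fun_mult; auto; apply continuous_fun_const.
  - intros n q; rewrite fourier_linear, E1, E2 by auto; ring.
Qed.

Lemma null_multiplier_one : null_multiplier (fun _ => 1).
Proof.
  intros h Hh; replace (fun x => h x * 1) with h; auto.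
  apply functional_extensionality; intros; ring.
Qed.

Lemma null_multiplier_pow m N :
  null_multiplier m -> null_multiplier (fun x => m x ^ N).
Proof.
  intros Hm; induction N as [|N IH]; [apply null_multiplier_one|].
  intros h Hh; specialize (IH _ (Hm h Hh)).
  replace (fun x => h x * m x ^ S N) with (fun x => h x * m x * m x ^ N); auto.
  apply functional_extensionality; intros; simpl; ring.
Qed.

Lemma Bernoulli_inequality x N : 0 <= x -> 1 + INR N * x <= (1 + x) ^ N.
Proof.
  intros Hx; induction N as [|N IH]; [simpl; lra|].
  rewrite S_INR; simpl; pose proof (pos_INR N).
  assert (0 <= INR N * x * x) by (repeat apply Rmult_le_pos; auto).
  nra.
Qed.

Lemma null_integral h : fourier_null h -> RInt h 0 (2 * PI) = 0.
Proof.
  intros [_ H]; etransitivity; [|exact (H 0%nat true)]; unfold fourier.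
  apply RInt_pointwise; intros x; unfold trig; simpl.
  rewrite Rmult_0_l, cos_0; ring.
Qed.

(** Lebesgue's argument.  The trigonometric polynomial
    [P = 1 + cos (x - x0) - cos delta] lies in [[-1, 1]] away from [x0] and
    exceeds [1] near [x0], where [h] is bounded below by [h0 > 0].  The integral
    of [h * P ^ N], which vanishes, then grows at least linearly in [N]. *)
Lemma fourier_null_not_pos h x0 :
  fourier_null h -> 0 < x0 < 2 * PI -> 0 < h x0 -> False.
Proof.
  intros Hh Hx0 Hpos; pose proof PI_RGT_0 as Hpi.
  destruct Hh as [Hc Hnull].
  set (h0 := h x0 / 2).
  assert (Hloc : locally x0 (fun x => h0 < h x)).
  { apply (Hc x0 (fun y => h0 < y)), (open_gt h0); unfold h0; lra. }
  destruct Hloc as (d & Hd).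
  assert (Hd0 := cond_pos d).
  set (delta := Rmin (Rmin (d / 2) 1) (Rmin x0 (2 * PI - x0))).
  assert (Hdelta : 0 < delta /\ delta < d /\ delta <= 1 /\ delta <= x0 /\
                   delta <= 2 * PI - x0).
  { unfold delta; repeat split; unfold Rmin; repeat destruct Rle_dec; lra. }
  destruct Hdelta as (D0 & D1 & D2 & D3 & D4).
  assert (HPI3 := PI2_3_2).
  set (P := fun x => 1 + cos (x - x0) - cos delta).
  assert (HPm : null_multiplier P).
  { replace P with (fun x => (1 - cos delta) * 1 +
        1 * (cos x0 * cos x + sin x0 * sin x)).
    - apply (null_multiplier_linear (fun _ => 1)); [apply null_multiplier_one|].
      apply null_multiplier_linear; [apply null_multiplier_cos|apply null_multiplier_sin].
    - apply functional_extensionality; intros x; unfold P; rewrite cos_minus; ring. }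
  assert (HPc : continuous_fun P).
  { apply continuous_fun_derivable; intros x; unfold P; auto_derive; auto. }
  (* the positive part of [P - 1], which makes the Bernoulli bound on [P ^ N]
     usable on the whole period *)
  set (psi := fun x => (Rabs (P x - 1) + (P x - 1)) / 2).
  assert (Hpsi_c : continuous_fun psi).
  { unfold psi; apply (continuous_fun_mult (fun x => Rabs (P x - 1) + (P x - 1)));
      [|apply continuous_fun_const].
    assert (continuous_fun (fun x => P x - 1))
      by (apply (continuous_fun_plus P); [auto|apply continuous_fun_const]).
    apply continuous_fun_plus; auto; now apply continuous_fun_Rabs. }
  assert (Hpsi0 : forall x, 0 <= psi x).
  { intros x; unfold psi, Rabs; destruct Rcase_abs; lra. }
  assert (Hin : forall x, x0 - delta < x < x0 + delta -> 1 < P x).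
  { intros x Hx; unfold P.
    assert (cos delta < cos (x - x0)); [|lra].
    destruct (Rle_lt_dec 0 (x - x0)).
    - apply cos_decreasing_1; lra.
    - rewrite <- (cos_neg (x - x0)); apply cos_decreasing_1; lra. }
  assert (Hout : forall x, 0 <= x <= 2 * PI -> ~ (x0 - delta < x < x0 + delta) ->
                 -1 <= P x <= 1).
  { intros x Hx Hn; unfold P.
    assert (cos (x - x0) <= cos delta).
    { assert (Hgen : forall y, delta <= y <= 2 * PI - delta -> cos y <= cos delta).
      { intros y Hy; destruct (Rle_lt_dec y PI).
        - apply cos_decr_1; lra.
        - replace (cos y) with (cos (2 * PI - y)).
          + apply cos_decr_1; lra.
          + rewrite cos_minus, cos_2PI, sin_2PI; ring. }
      destruct (Rle_lt_dec 0 (x - x0)); [apply Hgen; lra|].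
      rewrite <- (cos_neg (x - x0)); apply Hgen; lra. }
    pose proof (COS_bound delta); pose proof (COS_bound (x - x0)); lra. }
  destruct (continuity_ab_maj (fun x => Rabs (h x)) 0 (2 * PI)) as (xm & Hmax & _).
  { lra. }
  { intros x _; apply continuity_pt_filterlim, continuous_fun_Rabs; auto. }
  set (B := Rabs (h xm)) in *.
  assert (HB0 : 0 <= B) by apply Rabs_pos.
  assert (Hlow : forall N x, 0 <= x <= 2 * PI ->
            - B + h0 * INR N * psi x <= h x * P x ^ N).
  { intros N x Hx; specialize (Hmax x Hx).
    destruct (classic (x0 - delta < x < x0 + delta)) as [HI|HO].
    - assert (Hhx : h0 < h x).
      { apply Hd; change (Rabs (x - x0) < d); apply Rabs_def1; lra. }
      assert (Epsi : psi x = P x - 1).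
      { unfold psi; rewrite Rabs_pos_eq; [lra|]; specialize (Hin x HI); lra. }
      rewrite Epsi; specialize (Hin x HI).
      pose proof (Bernoulli_inequality (P x - 1) N ltac:(lra)) as HBern.
      replace (1 + (P x - 1)) with (P x) in HBern by ring.
      assert (0 < h0) by (unfold h0; lra).
      pose proof (pos_INR N).
      assert (0 <= INR N * (P x - 1)) by (apply Rmult_le_pos; lra).
      assert (h0 * (1 + INR N * (P x - 1)) <= h x * P x ^ N)
        by (apply Rmult_le_compat; lra).
      nra.
    - assert (Epsi : psi x = 0).
      { specialize (Hout x Hx HO); unfold psi; rewrite Rabs_left1; lra. }
      rewrite Epsi, Rmult_0_r, Rplus_0_r.
      assert (HP1 : Rabs (P x ^ N) <= 1).
      { rewrite <- RPow_abs.
        assert (HPx : 0 <= Rabs (P x) <= 1).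
        { split; [apply Rabs_pos|apply Rabs_le, Hout; auto]. }
        clear - HPx; induction N as [|N IH]; simpl; [lra|].
        assert (0 <= Rabs (P x) ^ N) by (apply pow_le; lra); nra. }
      assert (Rabs (h x * P x ^ N) <= B).
      { rewrite Rabs_mult; pose proof (Rabs_pos (h x)); pose proof (Rabs_pos (P x ^ N)); nra. }
      pose proof (Rle_abs (- (h x * P x ^ N))); rewrite Rabs_Ropp in *; lra. }
  assert (HI : 0 < RInt psi 0 (2 * PI)).
  { rewrite <- (RInt_Chasles (V := R_CompleteNormedModule) psi 0 (x0 - delta) (2 * PI))
      by now apply ex_RInt_continuous_fun.
    rewrite <- (RInt_Chasles (V := R_CompleteNormedModule) psi (x0 - delta) (x0 + delta) (2 * PI))
      by now apply ex_RInt_continuous_fun.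
    assert (0 <= RInt psi 0 (x0 - delta))
      by (apply RInt_ge_0; [lra|now apply ex_RInt_continuous_fun|auto]).
    assert (0 <= RInt psi (x0 + delta) (2 * PI))
      by (apply RInt_ge_0; [lra|now apply ex_RInt_continuous_fun|auto]).
    assert (0 < RInt psi (x0 - delta) (x0 + delta)).
    { apply RInt_gt_0; [lra| |auto].
      intros x Hx; specialize (Hin x Hx); unfold psi; rewrite Rabs_pos_eq; lra. }
    unfold plus; simpl; lra. }
  set (J := RInt psi 0 (2 * PI)) in *.
  assert (Hgrow : forall N, h0 * INR N * J <= 2 * PI * B).
  { intros N.
    assert (E : RInt (fun x => h x * P x ^ N) 0 (2 * PI) = 0).
    { apply null_integral, (null_multiplier_pow P N HPm); split; auto. }
    assert (Hpow : continuous_fun (fun x => h x * P x ^ N)).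
    { apply (null_multiplier_pow P N HPm); split; auto. }
    assert (L : RInt (fun x => (- B) * 1 + (h0 * INR N) * psi x) 0 (2 * PI) <=
                RInt (fun x => h x * P x ^ N) 0 (2 * PI)).
    { apply RInt_le; [lra| |now apply ex_RInt_continuous_fun|].
      - apply ex_RInt_continuous_fun, continuous_fun_plus;
          apply continuous_fun_mult; auto; apply continuous_fun_const.
      - intros x Hx; specialize (Hlow N x ltac:(lra)); lra. }
    rewrite E, (RInt_linear (fun _ => 1)) in L; auto; [|apply continuous_fun_const].
    rewrite RInt_const in L; unfold scal in L; simpl in L; unfold mult in L; simpl in L.
    fold J in L; lra. }
  destruct (INR_unbounded (2 * PI * B / (h0 * J))) as (N & HN).
  assert (Hh0J : 0 < h0 * J) by (apply Rmult_lt_0_compat; unfold h0; lra).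
  apply Rlt_div_l in HN; auto.
  specialize (Hgrow N); lra.
Qed.

Lemma fourier_null_zero h :
  fourier_null h -> periodic h -> forall x, h x = 0.
Proof.
  intros Hh Hper; pose proof PI_RGT_0 as Hpi.
  assert (Hin : forall x, 0 < x < 2 * PI -> h x = 0).
  { intros x Hx; destruct (Rtotal_order (h x) 0) as [Hneg|[|Hpos]]; auto; exfalso.
    - apply (fourier_null_not_pos (fun y => (-1) * h y) x); auto; [|lra].
      destruct Hh as [Hc H0]; split.
      + apply continuous_fun_mult; auto; apply continuous_fun_const.
      + intros n q; now apply fourier_scal.
    - now apply (fourier_null_not_pos h x). }
  assert (H0 : h 0 = 0).
  { destruct Hh as [Hc _]; destruct (Req_dec (h 0) 0) as [|Hne]; auto; exfalso.
    destruct (Hc 0 (fun y => y <> 0)) as (d & Hd).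
    { now apply (open_neq 0). }
    set (x := Rmin (d / 2) 1); assert (Hd0 := cond_pos d).
    assert (Hx : 0 < x /\ x < d /\ x <= 1)
      by (unfold x, Rmin; destruct Rle_dec; lra).
    assert (HPI3 := PI2_3_2).
    apply (Hd x); [|apply Hin; lra].
    change (Rabs (x - 0) < d); rewrite Rabs_pos_eq; lra. }
  assert (Hnat : forall n x, h (x + INR n * (2 * PI)) = h x).
  { induction n as [|n IH]; intros x; [f_equal; simpl; ring|].
    transitivity (h (x + INR n * (2 * PI) + 2 * PI)); [|now rewrite Hper].
    f_equal; rewrite S_INR; ring. }
  intros x.
  destruct (euclidian_division x (2 * PI)) as (z & r & E & Hr); [lra|].
  rewrite Rabs_pos_eq in Hr by lra.
  assert (Ehr : h r = 0).
  { destruct (Req_dec r 0) as [->|]; auto; apply Hin; lra. }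
  rewrite <- Ehr, E.
  destruct (Z.le_gt_cases 0 z) as [Hz|Hz].
  - rewrite <- (Hnat (Z.to_nat z) r), INR_IZR_INZ, Z2Nat.id by auto.
    f_equal; ring.
  - rewrite <- (Hnat (Z.to_nat (- z)) (_ + r)), INR_IZR_INZ, Z2Nat.id by lia.
    f_equal; rewrite opp_IZR; ring.
Qed.

(** ** Orthogonality *)

(** For distinct frequencies, the integrand times [n^2 - m^2] is the derivative
    of the Wronskian of the two functions, which is periodic. *)
Lemma fourier_trig_orthogonal n q m q' :
  (n, q) <> (m, q') -> fourier (trig n q) m q' = 0.
Proof.
  intros Hne.
  assert (Hper0 : forall h, periodic h -> h (2 * PI) = h 0).
  { intros h Hh; rewrite <- (Hh 0); f_equal; ring. }
  destruct (Nat.eq_dec n m) as [->|Hnm].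
  - assert (E : fourier (trig m q) m q' = RInt (fun x => trig m true x * trig m false x) 0 (2 * PI)).
    { apply RInt_pointwise; intros x.
      destruct q, q'; try (exfalso; apply Hne; reflexivity); ring. }
    rewrite E; clear E.
    destruct (Req_dec (INR m) 0) as [Hm|Hm].
    + rewrite (RInt_pointwise _ (fun _ => 0)).
      * rewrite RInt_const; apply Rmult_0_r.
      * intros x; unfold trig; rewrite Hm, Rmult_0_l, sin_0; ring.
    + rewrite (RInt_derivative (fun x => trig m false x ^ 2 / (2 * INR m))).
      * rewrite (Hper0 _ (trig_periodic m false)); ring.
      * intros x; unfold trig; auto_derive; auto; field; auto.
      * apply continuous_fun_mult; apply continuous_trig.
  - assert (Hd : forall p r, (p < r)%nat -> INR p ^ 2 - INR r ^ 2 <> 0).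
    { intros p r Hpr; apply lt_INR in Hpr; pose proof (pos_INR p); nra. }
    assert (Hd' : INR n ^ 2 - INR m ^ 2 <> 0).
    { destruct (Nat.lt_gt_cases n m) as [H _]; destruct (H Hnm) as [Hlt|Hlt].
      - now apply Hd.
      - specialize (Hd _ _ Hlt); lra. }
    apply (Rmult_eq_reg_l (INR n ^ 2 - INR m ^ 2)); auto; rewrite Rmult_0_r.
    transitivity (RInt (fun x => (INR n ^ 2 - INR m ^ 2) * (trig n q x * trig m q' x)
                                 + 0 * (trig n q x * trig m q' x)) 0 (2 * PI)).
    + rewrite RInt_linear; try (apply continuous_fun_mult; apply continuous_trig).
      unfold fourier; ring.
    + rewrite (RInt_derivative
        (fun x => trig n q x * trig' m q' x - trig' n q x * trig m q' x)).
      * rewrite !(Hper0 _ (trig_periodic _ _)), !(Hper0 _ (trig'_periodic _ _)); ring.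
      * intros x; eapply is_derive_value;
          [apply is_derive_diff; apply is_derive_prod;
           [apply is_derive_trig|apply is_derive_trig'
           |apply is_derive_trig'|apply is_derive_trig]|cbv beta; ring].
      * apply continuous_fun_plus; apply continuous_fun_mult;
          try apply continuous_fun_const; apply continuous_fun_mult; apply continuous_trig.
Qed.

Lemma fourier_trig_self n q :
  (n <> 0%nat \/ q = true) -> fourier (trig n q) n q <> 0.
Proof.
  intros Hv; pose proof PI_RGT_0 as Hpi; unfold fourier.
  destruct n as [|n].
  - destruct Hv as [Hv| ->]; [lia|].
    rewrite (RInt_pointwise _ (fun _ => 1)).
    + rewrite RInt_const; unfold scal; simpl; unfold mult; simpl; lra.
    + intros x; unfold trig; simpl; rewrite Rmult_0_l, cos_0; ring.
  - assert (HS : INR (S n) <> 0) by (apply not_0_INR; lia).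
    set (s := if q then 1 else -1).
    rewrite (RInt_derivative (fun x => x / 2 +
       s * (trig (S n) false x * trig (S n) true x) / (2 * INR (S n)))).
    + assert (E : forall m q, trig m q (2 * PI) = trig m q 0).
      { intros; rewrite <- (trig_periodic m q0 0); f_equal; ring. }
      rewrite !E; lra.
    + intros x; pose proof (sin2_cos2 (INR (S n) * x)) as Hsc; unfold Rsqr in Hsc.
      unfold trig; set (N := INR (S n)) in *; clearbody N; auto_derive; auto.
      set (si := sin (N * x)) in *; set (co := cos (N * x)) in *.
            transitivity (/ 2 + s * (co * co - si * si) / 2); [field; auto|].
      unfold s; destruct q; nra.
    + apply continuous_fun_mult; apply continuous_trig.
Qed.

(** * Harmonic functions on the cylinder *)

(** Solutions of a linear equation [h'' = mu h]: a class closed under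
    differentiation, hence made of smooth functions. *)
Definition oscillator (h : R -> R) : Prop :=
  exists k mu, (forall x, is_derive h x (k x)) /\
               (forall x, is_derive k x (mu * h x)).

Lemma oscillator_Derive h k mu :
  (forall x, is_derive h x (k x)) -> (forall x, is_derive k x (mu * h x)) ->
  Derive h = k /\ oscillator k.
Proof.
  intros Hh Hk; split.
  - apply functional_extensionality; intros x; now apply is_derive_unique.
  - exists (fun x => mu * h x), mu; split; auto.
    intros x; apply (is_derive_scal h x mu (k x)), Hh.
Qed.

Lemma oscillator_smooth h : oscillator h -> smooth h.
Proof.
  intros Ho.
  assert (Hn : forall n, oscillator (Derive_n h n)).
  { induction n as [|n (k & mu & Hh & Hk)]; auto; simpl.
    destruct (oscillator_Derive _ _ _ Hh Hk) as [E Hosc].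
    change (oscillator (Derive (Derive_n h n))); now rewrite E. }
  intros [|n] x; simpl; auto.
  destruct (Hn n) as (k & mu & Hh & _); now exists (k x).
Qed.

Lemma oscillator_product_smooth2 h k :
  oscillator h -> oscillator k -> smooth2 (fun t theta => h t * k theta).
Proof.
  intros Hh Hk n; revert h k Hh Hk; induction n as [|n IH];
    intros h k (h' & mu & Dh & Dh') (k' & nu & Dk & Dk').
  - intros t theta; apply continuity_2d_pt_mult.
    + apply (continuity_1d_2d_pt_comp h); [|apply continuity_2d_pt_id1].
      apply continuity_pt_filterlim, (continuous_fun_derivable h).
      intros x; now exists (h' x).
    + apply (continuity_1d_2d_pt_comp k); [|apply continuity_2d_pt_id2].
      apply continuity_pt_filterlim, (continuous_fun_derivable k).
      intros x; now exists (k' x).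
  - destruct (oscillator_Derive _ _ _ Dh Dh') as [Eh Hh'].
    destruct (oscillator_Derive _ _ _ Dk Dk') as [Ek Hk'].
    split; [|split].
    + intros t theta; split.
      * exists (h' t * k theta).
        apply (is_derive_ext (fun s => k theta * h s)); [intros; apply Rmult_comm|].
        rewrite Rmult_comm; apply is_derive_scal, Dh.
      * exists (h t * k' theta); apply is_derive_scal, Dk.
    + replace (d_t (fun t theta => h t * k theta)) with (fun t theta => h' t * k theta).
      * apply IH; auto; now exists k', nu.
      * apply functional_extensionality; intros t; apply functional_extensionality; intros theta.
        unfold d_t; now rewrite Derive_scal_l, <- Eh.
    + replace (d_theta (fun t theta => h t * k theta)) with (fun t theta => h t * k' theta).
      * apply IH; auto; now exists h', mu.
      * apply functional_extensionality; intros t; apply functional_extensionality; intros theta.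
        unfold d_theta; now rewrite Derive_scal, <- Ek.
Qed.

Lemma smooth2_facts U :
  smooth2 U ->
  (forall t theta, continuity_2d_pt U t theta) /\
  (forall t theta, ex_derive (fun s => U s theta) t) /\
  (forall t theta, ex_derive (U t) theta) /\
  smooth2 (d_t U) /\ smooth2 (d_theta U).
Proof.
  intros HU; split; [exact (HU 0%nat)|].
  destruct (HU 1%nat) as [Hd _].
  split; [exact (fun t theta => proj1 (Hd t theta))|].
  split; [exact (fun t theta => proj2 (Hd t theta))|].
  split; intros n; destruct (HU (S n)) as (_ & H1 & H2); [exact H1|exact H2].
Qed.

Lemma is_derive_fourier U n q t :
  smooth2 U ->
  is_derive (fun s => fourier (U s) n q) t (fourier (d_t U t) n q).
Proof.
  intros HU; destruct (smooth2_facts U HU) as (_ & Dt & Dth & Ht & _).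
  destruct (smooth2_facts _ Ht) as (Ct & _).
  assert (E : forall s theta, Derive (fun z => U z theta * trig n q theta) s =
                              d_t U s theta * trig n q theta).
  { intros; unfold d_t; apply Derive_scal_l. }
  replace (fourier (d_t U t) n q) with
    (RInt (fun theta => Derive (fun z => U z theta * trig n q theta) t) 0 (2 * PI))
    by (apply RInt_pointwise; intros; apply E).
  apply (is_derive_RInt_param (fun s theta => U s theta * trig n q theta)).
  - apply filter_forall; intros s theta _.
    apply (ex_derive_mult (fun z => U z theta) (fun _ => trig n q theta));
      [apply Dt|apply ex_derive_const].
  - intros theta _.
    apply (continuity_2d_pt_ext (fun s z => d_t U s z * trig n q z)).
    { intros; symmetry; apply E. }
    apply continuity_2d_pt_mult; [apply Ct|].
    apply (continuity_1d_2d_pt_comp (trig n q)); [|apply continuity_2d_pt_id2].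
    apply continuity_pt_filterlim, continuous_trig.
  - apply filter_forall; intros s; apply ex_RInt_continuous_fun.
    apply continuous_fun_mult; [|apply continuous_trig].
    apply continuous_fun_derivable; intros theta; apply Dth.
Qed.

Lemma periodic_Derive h x :
  periodic h -> Derive h (x + 2 * PI) = Derive h x.
Proof.
  intros Hh; unfold Derive; f_equal.
  apply Lim_ext; intros y.
  replace (x + 2 * PI + y) with (x + y + 2 * PI) by ring.
  now rewrite !Hh.
Qed.

(** Integration by parts twice; the boundary terms cancel by periodicity. *)
Lemma fourier_d_theta_twice U n q t :
  smooth2 U -> periodic (U t) ->
  fourier (d_theta (d_theta U) t) n q = - INR n ^ 2 * fourier (U t) n q.
Proof.
  intros HU Hper; destruct (smooth2_facts U HU) as (_ & _ & D1 & _ & H1).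
  destruct (smooth2_facts _ H1) as (_ & _ & D2 & _ & H2).
  destruct (smooth2_facts _ H2) as (_ & _ & D3 & _ & _).
  assert (C0 : continuous_fun (U t)) by (apply continuous_fun_derivable; auto).
  assert (C2 : continuous_fun (d_theta (d_theta U) t)) by (apply continuous_fun_derivable; auto).
  assert (E : RInt (fun x => 1 * (d_theta (d_theta U) t x * trig n q x) +
                INR n ^ 2 * (U t x * trig n q x)) 0 (2 * PI) = 0 :> R).
  { rewrite (RInt_derivative
      (fun x => d_theta U t x * trig n q x - U t x * trig' n q x)).
    - rewrite <- (Rplus_0_l (2 * PI)), trig_periodic, trig'_periodic, (Hper 0).
      change (d_theta U t (0 + 2 * PI)) with (Derive (U t) (0 + 2 * PI)).
      rewrite (periodic_Derive _ 0 Hper).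
      change (Derive (U t) 0) with (d_theta U t 0); ring.
    - intros x; eapply is_derive_value.
      + apply is_derive_diff; apply is_derive_prod;
          [apply Derive_correct, D2|apply is_derive_trig|
           apply Derive_correct, D1|apply is_derive_trig'].
      + change (Derive (d_theta U t) x) with (d_theta (d_theta U) t x).
        change (Derive (U t) x) with (d_theta U t x); ring.
    - apply continuous_fun_plus; apply continuous_fun_mult;
        try apply continuous_fun_const; apply continuous_fun_mult; auto; apply continuous_trig. }
  rewrite RInt_linear in E; try (apply continuous_fun_mult; auto; apply continuous_trig).
  unfold fourier; lra.
Qed.

(** ** The radial equation [h'' = n ^ 2 h] *)

(** [radial_C n] and [radial_S n] are the solutions with Cauchy data [(1, 0)]
    and [(0, 1)] at the origin. *)
Definition radial_C (n : nat) (t : R) : R := cosh (INR n * t).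
Definition radial_S (n : nat) (t : R) : R :=
  match n with O => t | S _ => sinh (INR n * t) / INR n end.

Lemma radial_C_0 n : radial_C n 0 = 1.
Proof. unfold radial_C; now rewrite Rmult_0_r, cosh_0. Qed.

Lemma radial_S_0 n : radial_S n 0 = 0.
Proof.
  unfold radial_S; destruct n; auto; rewrite Rmult_0_r, sinh_0; unfold Rdiv; ring.
Qed.

Lemma is_derive_cosh x : is_derive cosh x (sinh x).
Proof. apply is_derive_Reals, derivable_pt_lim_cosh. Qed.

Lemma is_derive_sinh x : is_derive sinh x (cosh x).
Proof. apply is_derive_Reals, derivable_pt_lim_sinh. Qed.

Lemma is_derive_radial_S n t : is_derive (radial_S n) t (radial_C n t).
Proof.
  unfold radial_S, radial_C; destruct n as [|n].
  - simpl; rewrite Rmult_0_l, cosh_0; apply (is_derive_id (K := R_AbsRing)).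
  - assert (INR (S n) <> 0) by (apply not_0_INR; lia).
    apply (is_derive_ext (fun s => / INR (S n) * sinh (0 + INR (S n) * s)));
      [intros; rewrite Rplus_0_l; apply Rmult_comm|].
    eapply is_derive_value; [apply is_derive_scal, is_derive_affine, is_derive_sinh|].
    rewrite Rplus_0_l; simpl; field; auto.
Qed.

Lemma is_derive_radial_C n t : is_derive (radial_C n) t (INR n ^ 2 * radial_S n t).
Proof.
  unfold radial_C; apply (is_derive_ext (fun s => cosh (0 + INR n * s)));
    [intros; now rewrite Rplus_0_l|].
  eapply is_derive_value; [apply is_derive_affine, is_derive_cosh|].
  rewrite Rplus_0_l; unfold radial_S; destruct n as [|n].
  - simpl; ring.
  - field; apply not_0_INR; lia.
Qed.

Lemma cosh_sinh_sq x : cosh x ^ 2 - sinh x ^ 2 = 1.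
Proof.
  unfold cosh, sinh; assert (exp x * exp (- x) = 1).
  { rewrite <- exp_plus, Rplus_opp_r; apply exp_0. }
  lra.
Qed.

Lemma radial_CS n t : radial_C n t ^ 2 - INR n ^ 2 * radial_S n t ^ 2 = 1.
Proof.
  unfold radial_C, radial_S; destruct n as [|n].
  - simpl INR; rewrite Rmult_0_l, cosh_0; ring.
  - rewrite <- (cosh_sinh_sq (INR (S n) * t)); field; apply not_0_INR; lia.
Qed.

Lemma sinh_pos x : 0 < x -> 0 < sinh x.
Proof. intros Hx; rewrite <- sinh_0; now apply sinh_lt. Qed.

Lemma cosh_pos x : 0 < cosh x.
Proof. unfold cosh; pose proof (exp_pos x); pose proof (exp_pos (- x)); lra. Qed.

Lemma radial_S_pos n t : 0 < t -> 0 < radial_S n t.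
Proof.
  intros Ht; unfold radial_S; destruct n as [|n]; auto.
  assert (0 < INR (S n)) by (apply lt_0_INR; lia).
  apply Rdiv_lt_0_compat; auto; apply sinh_pos; now apply Rmult_lt_0_compat.
Qed.

(** ** Steklov eigenfunctions of a conformal metric *)

Section Eigenspace.

Variables (f : R -> R) (T : R).
Hypothesis HT : 0 < T.
Hypothesis Hf : forall t, 0 <= t <= T -> 0 < f t.

Let g := conformal_metric f.

Lemma vol_conformal t theta : 0 < f t -> vol g t theta = f t ^ 2.
Proof.
  intros Ht; unfold vol, g; simpl.
  replace (f t * (f t * 1) * (f t * (f t * 1)) - 0 * (0 * 1)) with ((f t ^ 2) ^ 2) by ring.
  rewrite sqrt_pow2; [ring|apply pow2_ge_0].
Qed.

Lemma grad_t_conformal U t theta :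
  0 < f t -> grad_t g U t theta = d_t U t theta / f t ^ 2.
Proof.
  intros Ht; unfold grad_t, inv_tt, inv_tz; rewrite vol_conformal by auto.
  unfold g; simpl; field; lra.
Qed.

Lemma grad_theta_conformal U t theta :
  0 < f t -> grad_theta g U t theta = d_theta U t theta / f t ^ 2.
Proof.
  intros Ht; unfold grad_theta, inv_zz, inv_tz; rewrite vol_conformal by auto.
  unfold g; simpl; field; lra.
Qed.

(** In dimension two the conformal factor cancels in [vol g] times the gradient:
    the harmonic functions are those of the flat cylinder. *)
Lemma laplacian_conformal U t theta :
  0 < t < T ->
  laplacian g U t theta =
  (d_t (d_t U) t theta + d_theta (d_theta U) t theta) / f t ^ 2.
Proof.
  intros Ht; unfold laplacian; rewrite vol_conformal by (apply Hf; lra).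
  assert (E1 : d_t (fun s z => vol g s z * grad_t g U s z) t theta = d_t (d_t U) t theta).
  { unfold d_t at 1 2; apply Derive_ext_loc.
    assert (Hop : locally t (fun s => 0 < s < T))
      by (apply (open_and (fun s => 0 < s) (fun s => s < T)); [apply open_gt|apply open_lt|auto]).
    apply (filter_imp (fun s => 0 < s < T)); auto.
    intros s Hs; specialize (Hf s ltac:(lra)).
    rewrite vol_conformal, grad_t_conformal by auto; field; lra. }
  assert (E2 : d_theta (fun s z => vol g s z * grad_theta g U s z) t theta =
               d_theta (d_theta U) t theta).
  { unfold d_theta at 1 2; apply Derive_ext; intros z.
    specialize (Hf t ltac:(lra)).
    rewrite vol_conformal, grad_theta_conformal by auto; field; lra. }
  rewrite E1, E2; unfold Rdiv; ring.
Qed.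

Lemma position_range b : 0 <= position T b <= T.
Proof. destruct b; simpl; lra. Qed.

Lemma normal_derivative_conformal U b theta :
  normal_derivative g T U b theta =
  outward_sign b * d_t U (position T b) theta / f (position T b).
Proof.
  pose proof (Hf _ (position_range b)) as Hp.
  unfold normal_derivative; rewrite grad_t_conformal by auto.
  unfold inv_tt; rewrite vol_conformal by auto.
  unfold g, conformal_metric; cbn [g_zz].
  set (p := f (position T b)) in *.
  replace (p ^ 2 / (p ^ 2) ^ 2) with ((/ p) ^ 2) by (field; lra).
  rewrite sqrt_pow2 by (left; now apply Rinv_0_lt_compat).
  field; lra.
Qed.

(** Pairing the radial equation of the [n]-th Fourier coefficient [a] of the
    harmonic extension with a solution [e]: the Wronskian [a' e - a e'] has the
    same value at both ends. *)
Lemma fourier_wronskian U n q (e e' : R -> R) :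
  smooth2 U -> (forall t, 0 <= t <= T -> periodic (U t)) ->
  (forall t theta, 0 < t < T -> laplacian g U t theta = 0) ->
  (forall t, is_derive e t (e' t)) -> (forall t, is_derive e' t (INR n ^ 2 * e t)) ->
  fourier (d_t U T) n q * e T - fourier (U T) n q * e' T =
  fourier (d_t U 0) n q * e 0 - fourier (U 0) n q * e' 0.
Proof.
  intros HU Hper Hlap De De'.
  destruct (smooth2_facts U HU) as (_ & _ & _ & Ht & _).
  destruct (mean_value
    (fun t => fourier (d_t U t) n q * e t - fourier (U t) n q * e' t)
    (fun t => (fourier (d_t (d_t U) t) n q - INR n ^ 2 * fourier (U t) n q) * e t)
    0 T HT) as (c & Hc & E).
  - intros t _; eapply is_derive_value.
    + apply is_derive_diff; apply is_derive_prod;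
        [now apply is_derive_fourier|apply De|now apply is_derive_fourier|apply De'].
    + cbv beta; ring.
  - enough (fourier (d_t (d_t U) c) n q = INR n ^ 2 * fourier (U c) n q) as E2
      by (rewrite E2 in E; lra).
    replace (INR n ^ 2 * fourier (U c) n q) with
      (- fourier (d_theta (d_theta U) c) n q)
      by (rewrite fourier_d_theta_twice by (auto; apply Hper; lra); ring).
    unfold fourier.
    rewrite <- (Ropp_involutive (RInt (fun theta => d_t (d_t U) c theta * _) _ _)); f_equal.
    rewrite <- (RInt_opp (V := R_CompleteNormedModule)).
    + apply RInt_pointwise; intros theta.
      specialize (Hlap c theta Hc); rewrite laplacian_conformal in Hlap by auto.
      specialize (Hf c ltac:(lra)).
      assert (E0 : d_t (d_t U) c theta = - d_theta (d_theta U) c theta).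
      { apply (Rmult_eq_compat_r (f c ^ 2)) in Hlap.
        unfold Rdiv in Hlap; rewrite Rmult_assoc, Rinv_l in Hlap by (apply pow_nonzero; lra).
        lra. }
      rewrite E0; unfold opp; simpl; ring.
    + destruct (smooth2_facts _ Ht) as (_ & _ & _ & Htt & _).
      destruct (smooth2_facts _ Htt) as (_ & _ & D & _ & _).
      apply ex_RInt_continuous_fun, continuous_fun_mult; [|apply continuous_trig].
      apply continuous_fun_derivable; auto.
Qed.

(** Test functions vanishing at one end ([radial_S n t] and [radial_S n (T - t)])
    make the Wronskian identity a relation between the two boundary values of the
    Fourier coefficient; the Steklov condition supplies the derivatives. *)
Lemma eigenfunction_fourier lambda u n q :
  eigenspace g T lambda u ->
  fourier (u Left) n q =
    fourier (u Right) n q * (radial_C n T - lambda * f T * radial_S n T) /\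
  fourier (u Right) n q =
    fourier (u Left) n q * (radial_C n T - lambda * f 0 * radial_S n T).
Proof.
  intros (Hu & U & (HU & Hper & Hlap & Hbd) & HN).
  assert (Hpos0 : 0 < f 0) by (apply Hf; lra).
  assert (HposT : 0 < f T) by (apply Hf; lra).
  assert (C : forall b, continuous_fun (u b)).
  { intros b; apply continuous_fun_derivable; intros x; apply (proj1 (Hu b) 1%nat). }
  assert (E0 : fourier (U 0) n q = fourier (u Left) n q).
  { apply RInt_pointwise; intros x; now rewrite <- (Hbd Left). }
  assert (ET : fourier (U T) n q = fourier (u Right) n q).
  { apply RInt_pointwise; intros x; now rewrite <- (Hbd Right). }
  assert (Hscal : forall b r, fourier (fun x => r * u b x) n q = r * fourier (u b) n q).
  { intros b r; transitivity (fourier (fun x => r * u b x + 0 * u b x) n q).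
    - apply RInt_pointwise; intros; ring.
    - rewrite fourier_linear by auto; ring. }
  assert (D0 : fourier (d_t U 0) n q = - lambda * f 0 * fourier (u Left) n q).
  { rewrite <- Hscal; apply RInt_pointwise; intros x; f_equal.
    pose proof (HN Left x) as E; rewrite normal_derivative_conformal in E; simpl in E.
    apply (Rmult_eq_compat_r (f 0)) in E; field_simplify in E; lra. }
  assert (DT : fourier (d_t U T) n q = lambda * f T * fourier (u Right) n q).
  { rewrite <- Hscal; apply RInt_pointwise; intros x; f_equal.
    pose proof (HN Right x) as E; rewrite normal_derivative_conformal in E; simpl in E.
    apply (Rmult_eq_compat_r (f T)) in E; field_simplify in E; lra. }
  split.
  - pose proof (fourier_wronskian U n q (radial_S n) (radial_C n) HU Hper Hlap
      (is_derive_radial_S n) (is_derive_radial_C n)) as W.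
    rewrite E0, ET, D0, DT, radial_S_0, radial_C_0 in W; lra.
  - assert (Dr : forall h h' t, (forall s, is_derive h s (h' s)) ->
              is_derive (fun s => h (T - s)) t (- h' (T - t))).
    { intros h h' t Hh; apply (is_derive_ext (fun s => h (T + -1 * s)));
        [intros; f_equal; ring|].
      eapply is_derive_value; [apply is_derive_affine, Hh|].
      replace (T + -1 * t) with (T - t) by ring; ring. }
    pose proof (fourier_wronskian U n q (fun t => radial_S n (T - t))
      (fun t => - radial_C n (T - t)) HU Hper Hlap) as W.
    rewrite E0, ET, D0, DT, Rminus_0_r, Rminus_diag, radial_S_0, radial_C_0 in W.
    enough (fourier (u Right) n q = - lambda * f 0 * fourier (u Left) n q * radial_S n T
            - fourier (u Left) n q * - radial_C n T) by lra.
    rewrite <- W; [ring| |].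
    + intros t; apply Dr, is_derive_radial_S.
    + intros t; eapply is_derive_value.
      * apply (is_derive_opp (V := R_NormedModule) (fun t => radial_C n (T - t))).
        apply (Dr (radial_C n) (fun s => INR n ^ 2 * radial_S n s)), is_derive_radial_C.
      * unfold opp; simpl; ring.
Qed.

(** The boundary values of the radial solution normalised to [1] on the left
    circle and satisfying the Steklov condition there. *)
Definition amplitude (lambda : R) (n : nat) (b : boundary_circle) : R :=
  match b with
  | Left => 1
  | Right => radial_C n T - lambda * f 0 * radial_S n T
  end.

Definition separated (lambda : R) (n : nat) (q : bool) : boundary_function :=
  fun b theta => amplitude lambda n b * trig n q theta.

(** The hypothesis says that the two relations of [eigenfunction_fourier] are
    compatible, that is, that the radial solution with the Steklov condition at
    the left end satisfies it at the right end too. *)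
Lemma separated_eigenfunction lambda n q :
  (radial_C n T - lambda * f T * radial_S n T) *
  (radial_C n T - lambda * f 0 * radial_S n T) = 1 ->
  eigenspace g T lambda (separated lambda n q).
Proof.
  intros Hdet.
  assert (Hpos0 : 0 < f 0) by (apply Hf; lra).
  assert (HposT : 0 < f T) by (apply Hf; lra).
  assert (Otrig : forall r, oscillator (fun x => r * trig n q x)).
  { intros r; exists (fun x => r * trig' n q x), (- INR n ^ 2); split; intros x.
    - apply is_derive_scal, is_derive_trig.
    - eapply is_derive_value; [apply is_derive_scal, is_derive_trig'|simpl; ring]. }
  set (h := fun t => 1 * radial_C n t + (- lambda * f 0) * radial_S n t).
  set (h' := fun t => 1 * (INR n ^ 2 * radial_S n t) + (- lambda * f 0) * radial_C n t).
  assert (Dh : forall t, is_derive h t (h' t)).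
  { intros t; apply is_derive_sum; apply is_derive_scal;
      [apply is_derive_radial_C|apply is_derive_radial_S]. }
  assert (Dh' : forall t, is_derive h' t (INR n ^ 2 * h t)).
  { intros t; eapply is_derive_value.
    - apply is_derive_sum; apply is_derive_scal;
        [apply is_derive_scal, is_derive_radial_S|apply is_derive_radial_C].
    - unfold h; ring. }
  assert (Oh : oscillator h) by (exists h', (INR n ^ 2); auto).
  assert (Edt : forall t theta, d_t (fun t theta => h t * trig n q theta) t theta =
                                h' t * trig n q theta).
  { intros; unfold d_t; rewrite Derive_scal_l; f_equal; now apply is_derive_unique. }
  split.
  - intros b; split; [apply oscillator_smooth, Otrig|].
    intros x; unfold separated; now rewrite trig_periodic.
  - exists (fun t theta => h t * trig n q theta); split; [split; [|split; [|split]]|].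
    + apply oscillator_product_smooth2; auto.
      replace (trig n q) with (fun x => 1 * trig n q x); auto.
      apply functional_extensionality; intros; ring.
    + intros t _ x; now rewrite trig_periodic.
    + intros t theta Ht; rewrite laplacian_conformal by auto.
      replace (d_t (d_t (fun t theta => h t * trig n q theta)) t theta)
        with (INR n ^ 2 * h t * trig n q theta).
      * replace (d_theta (d_theta (fun t theta => h t * trig n q theta)) t theta)
          with (h t * (- INR n ^ 2 * trig n q theta)); [unfold Rdiv; ring|].
        symmetry; unfold d_theta at 1.
        rewrite (Derive_ext _ (fun z => h t * trig' n q z)).
        -- rewrite Derive_scal; f_equal; apply is_derive_unique, is_derive_trig'.
        -- intros z; unfold d_theta; rewrite Derive_scal; f_equal.
           apply is_derive_unique, is_derive_trig.
      * symmetry; unfold d_t at 1.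
        rewrite (Derive_ext _ (fun s => h' s * trig n q theta)) by (intros; apply Edt).
        rewrite Derive_scal_l; f_equal; now apply is_derive_unique.
    + intros b theta; unfold separated, h; destruct b; simpl.
      * rewrite radial_C_0, radial_S_0; ring.
      * ring.
    + intros b theta; rewrite normal_derivative_conformal, Edt.
      unfold separated, h'; destruct b; simpl position; simpl amplitude; simpl outward_sign.
      * rewrite radial_C_0, radial_S_0; field; lra.
      * pose proof (radial_CS n T) as HCS; pose proof (radial_S_pos n T HT) as HSp.
        set (C := radial_C n T) in *; set (Sn := radial_S n T) in *; set (N := INR n) in *.
        apply (Rmult_eq_reg_r (f T * Sn)); [|nra].
        assert (E : Sn * (N ^ 2 * Sn - lambda * f 0 * C) =
                    lambda * f T * Sn * (C - lambda * f 0 * Sn)) by nra.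
        transitivity (trig n q theta * (lambda * f T * Sn * (C - lambda * f 0 * Sn)));
          [ring|rewrite <- E; field; lra].
Qed.

End Eigenspace.

(** * The Steklov spectrum of a rotationally symmetric metric *)

Definition radial_quotient (n : nat) (T : R) : R := radial_C n T / radial_S n T.

Lemma radial_quotient_pos n T : 0 < T -> 0 < radial_quotient n T.
Proof. intros HT; apply Rdiv_lt_0_compat; [apply cosh_pos|now apply radial_S_pos]. Qed.

Lemma radial_quotient_sq n T :
  0 < T -> radial_quotient n T ^ 2 = INR n ^ 2 + / radial_S n T ^ 2.
Proof.
  intros HT; pose proof (radial_S_pos n T HT) as HS.
  unfold radial_quotient; unfold Rdiv; rewrite Rpow_mult_distr.
  replace (radial_C n T ^ 2) with (1 + INR n ^ 2 * radial_S n T ^ 2)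
    by (pose proof (radial_CS n T); lra).
  field; lra.
Qed.

Lemma radial_quotient_gt n T : 0 < T -> INR n < radial_quotient n T.
Proof.
  intros HT; pose proof (radial_quotient_sq n T HT) as E.
  pose proof (radial_quotient_pos n T HT); pose proof (pos_INR n).
  assert (0 < / radial_S n T ^ 2)
    by (apply Rinv_0_lt_compat, pow_lt, radial_S_pos, HT).
  apply Rnot_le_lt; intros Hle; nra.
Qed.

(** The normalised characteristic polynomial of frequency [n].  With
    [kappa = 4 f(0) f(T) / (f(0) + f(T))^2], the number [lambda] is an eigenvalue
    of frequency [n] if and only if [lambda * (f(0) + f(T))] is a root. *)
Definition char_poly (kappa T : R) (n : nat) (x : R) : R :=
  kappa / 4 * x ^ 2 - radial_quotient n T * x + INR n ^ 2.

Definition char_root (kappa T : R) (n : nat) (s : bool) : R :=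
  2 * (radial_quotient n T +
       (if s then 1 else -1) * sqrt (radial_quotient n T ^ 2 - kappa * INR n ^ 2)) / kappa.

Section CharRoots.

Variables (kappa T : R) (n : nat).
Hypothesis Hkappa : 0 < kappa <= 1.
Hypothesis HT : 0 < T.

Lemma discriminant_pos : 0 < radial_quotient n T ^ 2 - kappa * INR n ^ 2.
Proof.
  pose proof (radial_quotient_gt n T HT); pose proof (pos_INR n); nra.
Qed.

Lemma char_poly_factor x :
  char_poly kappa T n x =
  kappa / 4 * (x - char_root kappa T n false) * (x - char_root kappa T n true).
Proof.
  unfold char_poly, char_root.
  pose proof (pow2_sqrt _ (Rlt_le _ _ discriminant_pos)) as E.
  set (r := sqrt _) in *; set (e := radial_quotient n T) in *.
  transitivity (kappa / 4 * x ^ 2 - e * x + (e ^ 2 - r ^ 2) / kappa);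
    [rewrite E|]; field; lra.
Qed.

Lemma char_root_lt : char_root kappa T n false < char_root kappa T n true.
Proof.
  unfold char_root; pose proof (sqrt_lt_R0 _ discriminant_pos) as Hr.
  set (r := sqrt _) in *.
  apply Rmult_lt_compat_r; [apply Rinv_0_lt_compat|]; lra.
Qed.

Lemma char_poly_zero x :
  char_poly kappa T n x = 0 <-> exists s, x = char_root kappa T n s.
Proof.
  rewrite char_poly_factor; split.
  - intros H; apply Rmult_integral in H; destruct H as [H|H].
    + apply Rmult_integral in H; destruct H as [H|H]; [lra|].
      exists false; lra.
    + exists true; lra.
  - intros ([|] & ->); ring.
Qed.

Lemma char_root_zero s : char_poly kappa T n (char_root kappa T n s) = 0.
Proof. apply char_poly_zero; eauto. Qed.

Lemma char_root_ge_lower s : char_root kappa T n false <= char_root kappa T n s.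
Proof. destruct s; [left; apply char_root_lt|lra]. Qed.

Lemma lower_root_lt x :
  char_poly kappa T n x < 0 -> char_root kappa T n false < x.
Proof.
  rewrite char_poly_factor; intros H; pose proof char_root_lt.
  apply Rnot_le_lt; intros Hle.
  assert (0 <= (x - char_root kappa T n false) * (x - char_root kappa T n true)) by nra.
  nra.
Qed.

Lemma upper_root_lt x :
  0 < char_poly kappa T n x -> char_root kappa T n false < x ->
  char_root kappa T n true < x.
Proof.
  rewrite char_poly_factor; intros H Hx.
  apply Rnot_le_lt; intros Hle.
  assert (0 <= (x - char_root kappa T n false) * (char_root kappa T n true - x)) by nra.
  nra.
Qed.

Lemma char_poly_nonneg x :
  x <= char_root kappa T n false -> 0 <= char_poly kappa T n x.
Proof.
  rewrite char_poly_factor; intros H; pose proof char_root_lt.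
  assert (0 <= (x - char_root kappa T n false) * (x - char_root kappa T n true)) by nra.
  nra.
Qed.

(** Rationalising the numerator makes positivity and growth of the smaller root
    visible. *)
Lemma lower_root_formula :
  char_root kappa T n false =
  2 * INR n ^ 2 /
  (radial_quotient n T + sqrt (radial_quotient n T ^ 2 - kappa * INR n ^ 2)).
Proof.
  unfold char_root.
  pose proof (pow2_sqrt _ (Rlt_le _ _ discriminant_pos)) as E.
  pose proof (sqrt_pos (radial_quotient n T ^ 2 - kappa * INR n ^ 2)) as Hr.
  pose proof (radial_quotient_pos n T HT).
  set (r := sqrt _) in *; set (e := radial_quotient n T) in *.
  apply (Rmult_eq_reg_r (kappa * (e + r))); [|nra].
  transitivity (2 * (e ^ 2 - r ^ 2)); [field; lra|].
  rewrite E; field; lra.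
Qed.

(** This growth makes the spectrum locally finite. *)
Lemma lower_root_growth : INR n - / T <= char_root kappa T n false.
Proof.
  pose proof (radial_quotient_pos n T HT) as He.
  pose proof (pos_INR n) as Hn; pose proof (Rinv_0_lt_compat T HT) as HTi.
  assert (Hup : radial_quotient n T <= INR n + / T).
  { apply Rnot_lt_le; intros Hlt.
    pose proof (radial_quotient_sq n T HT) as E.
    assert (HS : T <= radial_S n T).
    { assert (radial_S n 0 - 0 <= radial_S n T - T).
      { apply (increment_nonneg (fun t => radial_S n t - t)
                 (fun t => radial_C n t - 1)); [lra| |].
        - intros x _; apply is_derive_diff; [apply is_derive_radial_S|].
          apply (is_derive_id (K := R_AbsRing)).
        - intros x _; pose proof (radial_CS n x).
          pose proof (pow2_ge_0 (INR n * radial_S n x)).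
          assert (0 < radial_C n x) by apply cosh_pos.
          apply Rnot_lt_le; intros; nra. }
      rewrite radial_S_0 in *; lra. }
    assert (/ radial_S n T ^ 2 <= (/ T) ^ 2).
    { rewrite pow_inv; apply Rinv_le_contravar; [nra|apply pow_incr; lra]. }
    nra. }
  assert (Hsq : sqrt (radial_quotient n T ^ 2 - kappa * INR n ^ 2) <= radial_quotient n T).
  { rewrite <- (sqrt_pow2 (radial_quotient n T)) at 2 by lra.
    apply sqrt_le_1_alt; pose proof (pow2_ge_0 (INR n)); nra. }
  pose proof (sqrt_pos (radial_quotient n T ^ 2 - kappa * INR n ^ 2)).
  rewrite lower_root_formula; set (r := sqrt _) in *; set (e := radial_quotient n T) in *.
  apply Rle_div_r; [lra|].
  destruct (Rle_lt_dec (INR n - / T) 0) as [Hneg|Hpos].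
  - assert (0 <= (/ T - INR n) * (e + r)) by (apply Rmult_le_pos; lra).
    pose proof (pow2_ge_0 (INR n)); nra.
  - apply Rle_trans with ((INR n - / T) * (2 * (INR n + / T))).
    + apply Rmult_le_compat_l; lra.
    + nra.
Qed.

End CharRoots.

Lemma char_poly_det f0 f1 T n lambda :
  0 < f0 -> 0 < f1 -> 0 < T ->
  (radial_C n T - lambda * f1 * radial_S n T) *
  (radial_C n T - lambda * f0 * radial_S n T) - 1 =
  radial_S n T ^ 2 *
  char_poly (4 * f0 * f1 / (f0 + f1) ^ 2) T n (lambda * (f0 + f1)).
Proof.
  intros H0 H1 HT; pose proof (radial_S_pos n T HT).
  replace 1 with (radial_C n T ^ 2 - INR n ^ 2 * radial_S n T ^ 2) by apply radial_CS.
  unfold char_poly, radial_quotient; field; split; lra.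
Qed.

(** One label for each eigenvalue, counted with multiplicity: a frequency, a
    choice of root ([true] for the larger one), and for positive frequency a
    parity. *)
Inductive mode := Radial (s : bool) | Wave (n : nat) (s q : bool).

Definition frequency (x : mode) : nat :=
  match x with Radial _ => 0%nat | Wave n _ _ => S n end.
Definition branch (x : mode) : bool :=
  match x with Radial s => s | Wave _ s _ => s end.
Definition parity (x : mode) : bool :=
  match x with Radial _ => true | Wave _ _ q => q end.

Definition mode_root (kappa T : R) (x : mode) : R :=
  char_root kappa T (frequency x) (branch x).

Lemma mode_ext x y :
  frequency x = frequency y -> branch x = branch y -> parity x = parity y -> x = y.
Proof. destruct x, y; simpl; intros; try discriminate; congruence. Qed.

Lemma mode_exists n s q :
  n <> 0%nat \/ q = true ->
  exists x, frequency x = n /\ branch x = s /\ parity x = q.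
Proof.
  intros H; destruct n as [|n].
  - exists (Radial s); simpl; intuition congruence.
  - now exists (Wave n s q).
Qed.

Lemma mode_valid x : frequency x <> 0%nat \/ parity x = true.
Proof. destruct x; simpl; auto. Qed.

Definition modes_upto (N : nat) : list mode :=
  [Radial true; Radial false] ++
  flat_map (fun n => [Wave n true true; Wave n true false;
                      Wave n false true; Wave n false false]) (seq 0 N).

Lemma modes_upto_complete N x : (frequency x <= N)%nat -> In x (modes_upto N).
Proof.
  intros Hx; unfold modes_upto; apply in_or_app.
  destruct x as [s|n s q]; simpl in Hx.
  - left; destruct s; simpl; auto.
  - right; apply in_flat_map; exists n; split; [apply in_seq; lia|].
    destruct s, q; simpl; auto.
Qed.

Section Spectrum.

Variables (f : R -> R) (T : R).
Hypothesis HT : 0 < T.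
Hypothesis Hf : forall t, 0 <= t <= T -> 0 < f t.

Let g := conformal_metric f.

Definition boundary_ratio : R := 4 * f 0 * f T / (f 0 + f T) ^ 2.

Definition mode_value (x : mode) : R := mode_root boundary_ratio T x / (f 0 + f T).

Let Hf0 : 0 < f 0.
Proof. apply Hf; lra. Qed.
Let HfT : 0 < f T.
Proof. apply Hf; lra. Qed.

Lemma boundary_ratio_range : 0 < boundary_ratio <= 1.
Proof.
  unfold boundary_ratio; split.
  - apply Rdiv_lt_0_compat; [|apply pow_lt; lra].
    repeat apply Rmult_lt_0_compat; lra.
  - apply Rle_div_l; [apply pow_lt; lra|].
    pose proof (pow2_ge_0 (f 0 - f T)); lra.
Qed.

Lemma boundary_ratio_one : boundary_ratio = 1 <-> f 0 = f T.
Proof.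
  unfold boundary_ratio; split; intros E.
  - assert (E2 : 4 * f 0 * f T = 4 * f 0 * f T / (f 0 + f T) ^ 2 * (f 0 + f T) ^ 2)
      by (field; lra).
    rewrite E in E2; assert ((f 0 - f T) ^ 2 = 0) by lra; nra.
  - rewrite E; field; lra.
Qed.

Lemma eigenvalue_condition n lambda :
  (radial_C n T - lambda * f T * radial_S n T) *
  (radial_C n T - lambda * f 0 * radial_S n T) = 1 <->
  exists s, lambda = char_root boundary_ratio T n s / (f 0 + f T).
Proof.
  pose proof (char_poly_det (f 0) (f T) T n lambda Hf0 HfT HT) as E.
  fold boundary_ratio in E; pose proof (radial_S_pos n T HT) as HS.
  assert (HS2 : 0 < radial_S n T ^ 2) by now apply pow_lt.
  split.
  - intros H; rewrite H in E.
    assert (H0 : char_poly boundary_ratio T n (lambda * (f 0 + f T)) = 0).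
    { apply (Rmult_eq_reg_l (radial_S n T ^ 2)); lra. }
    apply char_poly_zero in H0; [|apply boundary_ratio_range|auto].
    destruct H0 as (s & Hs); exists s; rewrite <- Hs; field; lra.
  - intros (s & Hs).
    replace (lambda * (f 0 + f T)) with (char_root boundary_ratio T n s) in E
      by (rewrite Hs; field; lra).
    rewrite char_root_zero in E by (auto; apply boundary_ratio_range); lra.
Qed.

Lemma mode_value_injective x y :
  mode_value x = mode_value y -> frequency x = frequency y -> parity x = parity y -> x = y.
Proof.
  intros E Hn Hq; apply mode_ext; auto.
  unfold mode_value, mode_root in E; rewrite <- Hn in E.
  assert (E' : char_root boundary_ratio T (frequency x) (branch x) =
               char_root boundary_ratio T (frequency x) (branch y)).
  { apply (Rmult_eq_reg_r (/ (f 0 + f T))); auto.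
    apply Rinv_neq_0_compat; lra. }
  pose proof (char_root_lt boundary_ratio T (frequency x) boundary_ratio_range HT).
  destruct (branch x), (branch y); auto; lra.
Qed.

Lemma mode_value_locally_finite c :
  exists l : list mode, forall x, mode_value x <= c -> In x l.
Proof.
  destruct (INR_unbounded (c * (f 0 + f T) + / T)) as (N & HN).
  exists (modes_upto N); intros x Hx; apply modes_upto_complete.
  apply INR_le; unfold mode_value, mode_root in Hx.
  apply Rle_div_l in Hx; [|lra].
  pose proof (char_root_ge_lower boundary_ratio T (frequency x) boundary_ratio_range HT (branch x)).
  pose proof (lower_root_growth boundary_ratio T (frequency x) boundary_ratio_range HT).
  lra.
Qed.

Definition mode_function (lambda : R) (x : mode) : boundary_function :=
  separated f T lambda (frequency x) (parity x).

Lemma continuous_mode_function lambda x b : continuous_fun (mode_function lambda x b).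
Proof.
  unfold mode_function, separated; apply continuous_fun_mult;
    [apply continuous_fun_const|apply continuous_trig].
Qed.

Lemma fourier_mode_function lambda x b n q :
  fourier (mode_function lambda x b) n q =
  amplitude f T lambda (frequency x) b * fourier (trig (frequency x) (parity x)) n q.
Proof.
  transitivity (fourier (fun y =>
      amplitude f T lambda (frequency x) b * trig (frequency x) (parity x) y +
      0 * trig (frequency x) (parity x) y) n q).
  - apply RInt_pointwise; intros; unfold mode_function, separated; ring.
  - rewrite fourier_linear by apply continuous_trig; ring.
Qed.

(** The separated functions attached to the modes of value [lambda] form a basis.
    They have distinct pairs (frequency, parity), because the two roots of one
    frequency differ, so each coefficient is read off from one Fourier
    coefficient on the left circle.  For spanning, the combination with these
    coefficients has the same Fourier coefficients as [u]: at a pair carried by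
    no mode, the relations of [eigenfunction_fourier] force those of [u] to
    vanish. *)
Lemma eigenspace_dimension lambda :
  exists l : list mode, NoDup l /\ (forall x, In x l <-> mode_value x = lambda) /\
    has_dimension (eigenspace g T lambda) (length l).
Proof.
  destruct (mode_value_locally_finite lambda) as (F & HF).
  destruct (exists_sublist F (fun x => mode_value x = lambda)) as (l & Hnd & Hl0).
  assert (Hl : forall x, In x l <-> mode_value x = lambda).
  { intros x; rewrite Hl0; split; [tauto|]; intros E; split; auto; apply HF; lra. }
  clear Hl0 F HF; exists l; split; [auto|split; [auto|]].
  set (x_ := fun i => nth i l (Radial true)).
  assert (Hin : forall i, (i < length l)%nat -> mode_value (x_ i) = lambda).
  { intros i Hi; apply Hl, nth_In; auto. }
  assert (Hsep : forall i j, (i < length l)%nat -> (j < length l)%nat -> i <> j ->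
            (frequency (x_ i), parity (x_ i)) <> (frequency (x_ j), parity (x_ j))).
  { intros i j Hi Hj Hij E; injection E as En Eq; apply Hij.
    apply (proj1 (NoDup_nth l (Radial true)) Hnd i j Hi Hj).
    apply mode_value_injective; auto; exact (eq_trans (Hin i Hi) (eq_sym (Hin j Hj))). }
  set (e := fun i => mode_function lambda (x_ i)).
  assert (Hcomb : forall c b n q,
            fourier (lin_comb c e (length l) b) n q =
            lsum (seq 0 (length l)) (fun i => c i * (amplitude f T lambda (frequency (x_ i)) b *
              fourier (trig (frequency (x_ i)) (parity (x_ i))) n q))).
  { intros c b n q.
    transitivity (fourier (fun y => lsum (seq 0 (length l)) (fun i => c i * e i b y)) n q);
      [reflexivity|].
    rewrite (fourier_lsum _ c (fun i => e i b)) by (intros; apply continuous_mode_function).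
    apply lsum_ext; intros; unfold e; now rewrite fourier_mode_function. }
  assert (Hsingle : forall c b i, (i < length l)%nat ->
            fourier (lin_comb c e (length l) b) (frequency (x_ i)) (parity (x_ i)) =
            c i * (amplitude f T lambda (frequency (x_ i)) b *
              fourier (trig (frequency (x_ i)) (parity (x_ i)))
                (frequency (x_ i)) (parity (x_ i)))).
  { intros c b i Hi; rewrite Hcomb.
    rewrite (lsum_single _ _ i); [reflexivity|apply seq_NoDup|apply in_seq; lia|].
    intros j Hj Hji; apply in_seq in Hj.
    rewrite fourier_trig_orthogonal; [ring|apply Hsep; auto; lia]. }
  exists e; split; [|split].
  - intros i Hi; apply separated_eigenfunction; auto.
    apply eigenvalue_condition; exists (branch (x_ i)); symmetry; now apply Hin.
  - intros c Hc i Hi; specialize (Hsingle c Left i Hi); simpl amplitude in Hsingle.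
    assert (E : fourier (lin_comb c e (length l) Left) (frequency (x_ i)) (parity (x_ i)) = 0).
    { unfold fourier; rewrite (RInt_pointwise _ (fun _ => 0)).
      - rewrite RInt_const; apply Rmult_0_r.
      - intros y; rewrite Hc; ring. }
    pose proof (fourier_trig_self _ _ (mode_valid (x_ i))) as Hne.
    rewrite Hsingle, Rmult_1_l in E; apply Rmult_integral in E; tauto.
  - intros u Hu.
    set (c := fun i => fourier (u Left) (frequency (x_ i)) (parity (x_ i)) /
                fourier (trig (frequency (x_ i)) (parity (x_ i)))
                  (frequency (x_ i)) (parity (x_ i))).
    exists c.
    assert (Cu : forall b, continuous_fun (u b)).
    { intros b; apply continuous_fun_derivable; intros y; apply (proj1 (proj1 Hu b) 1%nat). }
    assert (Ce : forall b, continuous_fun (lin_comb c e (length l) b)).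
    { intros b; apply (continuous_fun_lsum _ c (fun i => e i b)).
      intros; apply continuous_mode_function. }
    assert (Hnull : forall b n q, fourier (u b) n q = fourier (lin_comb c e (length l) b) n q).
    { intros b n q.
      destruct (eigenfunction_fourier f T HT Hf lambda u n q Hu) as [EL ER].
      destruct (classic (exists i, (i < length l)%nat /\
                  (frequency (x_ i), parity (x_ i)) = (n, q))) as [(i & Hi & E)|Hno].
      - injection E as <- <-; rewrite Hsingle by auto.
        pose proof (fourier_trig_self _ _ (mode_valid (x_ i))) as Hne.
        unfold c; destruct b; simpl amplitude; [|rewrite ER]; field; auto.
      - rewrite Hcomb, lsum_zero.
        2: { intros i Hi; apply in_seq in Hi; rewrite fourier_trig_orthogonal; [ring|].
             intros E; apply Hno; exists i; split; [lia|auto]. }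
        assert (EL0 : fourier (u Left) n q = 0).
        { destruct (classic (n <> 0%nat \/ q = true)) as [Hv|Hv].
          - apply NNPP; intros Hne; apply Hno.
            assert (Hdet : (radial_C n T - lambda * f T * radial_S n T) *
                           (radial_C n T - lambda * f 0 * radial_S n T) = 1).
            { apply (Rmult_eq_reg_l (fourier (u Left) n q)); auto.
              rewrite ER in EL; lra. }
            apply eigenvalue_condition in Hdet; destruct Hdet as (s & Hs).
            destruct (mode_exists n s q Hv) as (x & <- & <- & <-).
            destruct (In_nth l x (Radial true)) as (i & Hi & Ei); [now apply Hl|].
            exists i; split; auto; unfold x_; now rewrite Ei.
          - assert (n = 0%nat /\ q = false) as [-> ->]
              by (destruct n, q; intuition congruence).
            unfold fourier; rewrite (RInt_pointwise _ (fun _ => 0)).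
            + rewrite RInt_const; apply Rmult_0_r.
            + intros y; unfold trig; simpl; rewrite Rmult_0_l, sin_0; ring. }
        destruct b; [auto|rewrite ER, EL0; ring]. }
    intros b theta.
    assert (E : 1 * u b theta + (-1) * lin_comb c e (length l) b theta = 0); [|lra].
    apply (fourier_null_zero
             (fun y => 1 * u b y + (-1) * lin_comb c e (length l) b y)).
    + split.
      * apply continuous_fun_plus; apply continuous_fun_mult; auto; apply continuous_fun_const.
      * intros n q; rewrite fourier_linear, Hnull by auto; ring.
    + intros y; destruct Hu as [Hu _]; rewrite (proj2 (Hu b)); f_equal; f_equal.
      apply lsum_ext; intros i _; f_equal.
      unfold e, mode_function, separated; now rewrite trig_periodic.
Qed.

Lemma steklov_spectrum :
  (forall k, steklov g T k <= steklov g T (S k)) /\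
  same_multiplicities mode_value (steklov g T).
Proof.
  assert (Hex : exists sigma, is_steklov_spectrum g T sigma).
  { destruct (sorted_enumeration mode_value) as (sigma & Hs & Hm).
    - intros l; exists (Wave (list_max (map frequency l)) true true); intros Hin.
      apply (in_map frequency) in Hin; simpl in Hin.
      assert (H := proj1 (list_max_le (map frequency l) _) (Nat.le_refl _)).
      rewrite Forall_forall in H; specialize (H _ Hin); lia.
    - exact mode_value_locally_finite.
    - exists sigma; split; auto; intros lambda.
      destruct (Hm lambda) as (la & lb & Hla & Hlb & Hlen & Ha & Hb).
      destruct (eigenspace_dimension lambda) as (l & Hnd & Hl & Hdim).
      exists lb; split; auto; split; auto.
      rewrite <- Hlen; replace (length la) with (length l); auto.
      apply Nat.le_antisymm; apply NoDup_incl_length; auto;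
        intros x Hx; [apply Ha, Hl|apply Hl, Ha]; auto. }
  pose proof (epsilon_spec (inhabits (fun _ : nat => 0)) _ Hex) as [Hs Hspec].
  fold (steklov g T) in Hs, Hspec; split; auto.
  intros lambda; destruct (Hspec lambda) as (lb & Hnb & Hb & Hdb).
  destruct (eigenspace_dimension lambda) as (la & Hna & Ha & Hda).
  exists la, lb; repeat split; auto; try apply Ha; try apply Hb.
  apply (has_dimension_unique _ _ _ Hda Hdb).
Qed.

Lemma sigma_tilde_eq j : sigma_tilde f T j = 2 * PI * (steklov g T j * (f 0 + f T)).
Proof.
  assert (E : boundary_length g T = 2 * PI * (f 0 + f T)).
  { unfold boundary_length, g, conformal_metric; cbn [g_zz].
    rewrite !RInt_const, !sqrt_pow2 by lra.
    unfold scal; simpl; unfold mult; simpl; ring. }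
  unfold sigma_tilde, normalized_steklov; fold g; rewrite E; ring.
Qed.

Let Hsteklov := steklov_spectrum.

Lemma sigma_tilde_lt c l j :
  NoDup l -> (j < length l)%nat ->
  (forall x, In x l -> mode_root boundary_ratio T x < c) ->
  sigma_tilde f T j < 2 * PI * c.
Proof.
  intros Hnd Hj Hl; destruct Hsteklov as [Hs Hm].
  rewrite sigma_tilde_eq; pose proof PI_RGT_0; apply Rmult_lt_compat_l; [lra|].
  apply Rlt_div_r; [lra|].
  apply (sorted_lt mode_value _ _ l); auto.
  intros x Hx; apply Rmult_lt_compat_r; [apply Rinv_0_lt_compat; lra|auto].
Qed.

Lemma sigma_tilde_le c l j :
  NoDup l -> (j < length l)%nat ->
  (forall x, In x l -> mode_root boundary_ratio T x <= c) ->
  sigma_tilde f T j <= 2 * PI * c.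
Proof.
  intros Hnd Hj Hl; destruct Hsteklov as [Hs Hm].
  rewrite sigma_tilde_eq; pose proof PI_RGT_0; apply Rmult_le_compat_l; [lra|].
  apply Rle_div_r; [lra|].
  apply (sorted_le mode_value _ _ l); auto.
  intros x Hx; apply Rmult_le_compat_r; [left; apply Rinv_0_lt_compat; lra|auto].
Qed.

Lemma sigma_tilde_ge c l j :
  (length l <= j)%nat ->
  (forall x, mode_root boundary_ratio T x < c -> In x l) ->
  2 * PI * c <= sigma_tilde f T j.
Proof.
  intros Hj Hl; destruct Hsteklov as [Hs Hm].
  rewrite sigma_tilde_eq; pose proof PI_RGT_0; apply Rmult_le_compat_l; [lra|].
  apply Rle_div_l; [lra|].
  apply (sorted_ge mode_value _ _ l); auto.
  intros x Hx; apply Hl; unfold mode_value in Hx.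
  apply (Rmult_lt_reg_r (/ (f 0 + f T))); auto; apply Rinv_0_lt_compat; lra.
Qed.

End Spectrum.

(** * Hyperbolic inequalities *)

Lemma cosh_lt_nonneg x y : 0 <= x < y -> cosh x < cosh y.
Proof.
  intros Hxy; apply (increment_pos cosh sinh); [lra| |].
  - intros; apply is_derive_cosh.
  - intros; apply sinh_pos; lra.
Qed.

Lemma sinh_nonneg x : 0 <= x -> 0 <= sinh x.
Proof.
  intros [Hx| <-]; [left; now apply sinh_pos|rewrite sinh_0; lra].
Qed.

Lemma cosh_double x : cosh (2 * x) = 2 * cosh x ^ 2 - 1.
Proof.
  pose proof (cosh_sinh_sq x).
  replace (cosh (2 * x)) with (cosh x ^ 2 + sinh x ^ 2); [lra|].
  unfold cosh, sinh; replace (2 * x) with (x + x) by ring.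
  rewrite Ropp_plus_distr, !exp_plus; field.
Qed.

Lemma sinh_double x : sinh (2 * x) = 2 * sinh x * cosh x.
Proof.
  unfold cosh, sinh; replace (2 * x) with (x + x) by ring.
  rewrite Ropp_plus_distr, !exp_plus; field.
Qed.

Lemma sinh_plus x y : sinh (x + y) = sinh x * cosh y + cosh x * sinh y.
Proof. unfold cosh, sinh; rewrite Ropp_plus_distr, !exp_plus; field. Qed.

Lemma cosh_plus x y : cosh (x + y) = cosh x * cosh y + sinh x * sinh y.
Proof. unfold cosh, sinh; rewrite Ropp_plus_distr, !exp_plus; field. Qed.

Lemma cosh_opp x : cosh (- x) = cosh x.
Proof. unfold cosh; rewrite Ropp_involutive; field. Qed.

Lemma sinh_opp x : sinh (- x) = - sinh x.
Proof. unfold sinh; rewrite Ropp_involutive; field. Qed.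

(** ** Monotonicity of the radial quotients *)

Lemma radial_C_increasing m k t : (m < k)%nat -> 0 < t -> radial_C m t < radial_C k t.
Proof.
  intros Hmk Ht; apply lt_INR in Hmk; pose proof (pos_INR m).
  apply cosh_lt_nonneg; split; [apply Rmult_le_pos; lra|].
  now apply Rmult_lt_compat_r.
Qed.

Lemma radial_S_increasing m k t : (m < k)%nat -> 0 < t -> radial_S m t < radial_S k t.
Proof.
  intros Hmk Ht.
  assert (radial_S k 0 - radial_S m 0 < radial_S k t - radial_S m t).
  { apply (increment_pos (fun s => radial_S k s - radial_S m s)
             (fun s => radial_C k s - radial_C m s)); auto.
    - intros; apply is_derive_diff; apply is_derive_radial_S.
    - intros s Hs; pose proof (radial_C_increasing m k s Hmk ltac:(lra)); lra. }
  rewrite !radial_S_0 in *; lra.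
Qed.

Lemma is_derive_radial_quotient n t :
  0 < t -> is_derive (radial_quotient n) t (- / radial_S n t ^ 2).
Proof.
  intros Ht; pose proof (radial_S_pos n t Ht) as HS.
  eapply is_derive_value.
  - apply (is_derive_div (radial_C n) (radial_S n));
      [apply is_derive_radial_C|apply is_derive_radial_S|lra].
  - pose proof (radial_CS n t).
    replace (INR n ^ 2 * radial_S n t * radial_S n t - radial_C n t * radial_C n t)
      with (-1) by lra.
    field; lra.
Qed.

Lemma radial_quotient_decreasing n T T' :
  0 < T < T' -> radial_quotient n T' < radial_quotient n T.
Proof.
  intros HT; apply Ropp_lt_cancel.
  apply (increment_pos (fun t => - radial_quotient n t) (fun t => / radial_S n t ^ 2)); [lra| |].
  - intros t Ht; eapply is_derive_value.
    + apply (is_derive_opp (K := R_AbsRing) (V := R_NormedModule) (radial_quotient n)).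
      apply is_derive_radial_quotient; lra.
    + apply Ropp_involutive.
  - intros t Ht; apply Rinv_0_lt_compat, pow_lt, radial_S_pos; lra.
Qed.

Lemma radial_quotient_gap_increasing m k T T' :
  (m < k)%nat -> 0 < T < T' ->
  radial_quotient k T - radial_quotient m T < radial_quotient k T' - radial_quotient m T'.
Proof.
  intros Hmk HT.
  apply (increment_pos (fun t => radial_quotient k t - radial_quotient m t)
           (fun t => - / radial_S k t ^ 2 - - / radial_S m t ^ 2)); [lra| |].
  - intros t Ht; apply is_derive_diff; apply is_derive_radial_quotient; lra.
  - intros t Ht; pose proof (radial_S_increasing m k t Hmk ltac:(lra)).
    pose proof (radial_S_pos m t ltac:(lra)).
    assert (/ radial_S k t ^ 2 < / radial_S m t ^ 2); [|lra].
    apply Rinv_lt_contravar; [|nra].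
    apply Rmult_lt_0_compat; apply pow_lt; lra.
Qed.

(** After clearing denominators the difference vanishes at length [0] and has
    derivative [(k^2 - m^2) S_k S_m], with [S_n] short for [radial_S n]. *)
Lemma radial_quotient_increasing m k T :
  (m < k)%nat -> 0 < T -> radial_quotient m T < radial_quotient k T.
Proof.
  intros Hmk HT.
  pose proof (radial_S_pos m T HT); pose proof (radial_S_pos k T HT).
  assert (H1 : radial_C k 0 * radial_S m 0 - radial_C m 0 * radial_S k 0 <
               radial_C k T * radial_S m T - radial_C m T * radial_S k T).
  { apply (increment_pos (fun t => radial_C k t * radial_S m t - radial_C m t * radial_S k t)
      (fun t => (INR k ^ 2 - INR m ^ 2) * (radial_S k t * radial_S m t))); auto.
    - intros t _; eapply is_derive_value.
      + apply is_derive_diff; apply is_derive_prod;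
          [apply is_derive_radial_C|apply is_derive_radial_S
          |apply is_derive_radial_C|apply is_derive_radial_S].
      + ring.
    - intros t Ht; apply lt_INR in Hmk; pose proof (pos_INR m).
      apply Rmult_lt_0_compat; [nra|].
      apply Rmult_lt_0_compat; apply radial_S_pos; lra. }
  rewrite !radial_S_0 in H1.
  unfold radial_quotient; apply Rlt_div_l; auto.
  replace (radial_C k T / radial_S k T * radial_S m T) with
    (radial_C k T * radial_S m T / radial_S k T) by (field; lra).
  apply (Rlt_div_r (radial_C m T)); auto; lra.
Qed.

Lemma radial_quotient_scaling n T :
  n <> 0%nat -> 0 < T -> radial_quotient n T = INR n * radial_quotient 1 (INR n * T).
Proof.
  intros Hn HT; unfold radial_quotient, radial_C, radial_S.
  destruct n as [|n]; [lia|].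
  assert (0 < INR (S n)) by (apply lt_0_INR; lia).
  assert (0 < sinh (INR (S n) * T)) by (apply sinh_pos, Rmult_lt_0_compat; auto).
  replace (INR 1 * (INR (S n) * T)) with (INR (S n) * T) by (simpl (INR 1); ring).
  simpl (INR 1); field; lra.
Qed.

(** ** The pairing inequality *)

Definition shc (x : R) : R := sinh x / x.

(** The quotient [shc' / cosh'].  Its monotonicity controls the difference
    quotients of [shc] with respect to [cosh]. *)
Definition shc_slope (x : R) : R := (x * cosh x - sinh x) / (x ^ 2 * sinh x).

Lemma sinh_le_x_cosh x : 0 <= x -> sinh x <= x * cosh x.
Proof.
  intros Hx.
  assert (0 * cosh 0 - sinh 0 <= x * cosh x - sinh x); [|rewrite sinh_0 in *; lra].
  apply (increment_nonneg (fun y => y * cosh y - sinh y) (fun y => y * sinh y)); auto.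
  - intros y _; auto_derive; auto; ring.
  - intros y Hy; apply Rmult_le_pos; [lra|apply sinh_nonneg; lra].
Qed.

(** Differentiate twice: the second derivative factors as
    [4 sinh x (x cosh x - sinh x)]. *)
Lemma shc_slope_inequality x :
  0 <= x -> 0 <= x ^ 2 + x * sinh x * cosh x - 2 * sinh x ^ 2.
Proof.
  intros Hx.
  set (d1 := fun y => 2 * y - 3 * (sinh y * cosh y) + y * (cosh y ^ 2 + sinh y ^ 2)).
  set (d2 := fun y => 4 * sinh y * (y * cosh y - sinh y)).
  assert (H1 : forall y, 0 <= y -> 0 <= d1 y).
  { intros y Hy; replace 0 with (d1 0) by (unfold d1; rewrite sinh_0; ring).
    apply (increment_nonneg d1 d2); auto.
    - intros z _; unfold d1, d2; auto_derive; auto.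
      pose proof (cosh_sinh_sq z); nra.
    - intros z Hz; unfold d2; pose proof (sinh_le_x_cosh z ltac:(lra)).
      pose proof (sinh_nonneg z ltac:(lra)); nra. }
  replace 0 with (0 ^ 2 + 0 * sinh 0 * cosh 0 - 2 * sinh 0 ^ 2) at 1
    by (rewrite sinh_0; ring).
  apply (increment_nonneg (fun y => y ^ 2 + y * sinh y * cosh y - 2 * sinh y ^ 2) d1); auto.
  - intros y _; unfold d1; auto_derive; auto; ring.
  - intros y Hy; apply H1; lra.
Qed.

Lemma shc_slope_decreasing x y : 0 < x <= y -> shc_slope y <= shc_slope x.
Proof.
  intros Hxy; apply Ropp_le_cancel.
  apply (increment_nonneg (fun z => - shc_slope z)
    (fun z => (z ^ 2 + z * sinh z * cosh z - 2 * sinh z ^ 2) / (z ^ 3 * sinh z ^ 2))); [lra| |].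
  - intros z Hz; pose proof (sinh_pos z ltac:(lra)) as Hs.
    unfold shc_slope; auto_derive.
    + apply Rgt_not_eq, Rmult_lt_0_compat; auto; nra.
    + pose proof (cosh_sinh_sq z) as E.
      apply (Rmult_eq_reg_r (z ^ 4 * sinh z ^ 2));
        [|apply Rgt_not_eq, Rmult_lt_0_compat; apply pow_lt; lra].
      field_simplify; [|lra|lra].
      replace (cosh z ^ 2) with (1 + sinh z ^ 2) by lra; ring.
  - intros z Hz; pose proof (sinh_pos z ltac:(lra)) as Hs.
    apply Rdiv_le_0_compat; [apply shc_slope_inequality; lra|].
    apply Rmult_lt_0_compat; apply pow_lt; lra.
Qed.

Lemma is_derive_shc x : 0 < x -> is_derive shc x (shc_slope x * sinh x).
Proof.
  intros Hx; pose proof (sinh_pos x Hx); unfold shc, shc_slope; auto_derive; [lra|].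
  field; lra.
Qed.

Lemma shc_increment_lower x y :
  0 < x <= y -> shc_slope y * (cosh y - cosh x) <= shc y - shc x.
Proof.
  intros Hxy; set (r := shc_slope y).
  assert (shc x - r * cosh x <= shc y - r * cosh y); [|lra].
  apply (increment_nonneg (fun z => shc z - r * cosh z)
           (fun z => shc_slope z * sinh z - r * sinh z)); [lra| |].
  - intros z Hz; apply is_derive_diff; [apply is_derive_shc; lra|].
    apply is_derive_scal, is_derive_cosh.
  - intros z Hz; pose proof (shc_slope_decreasing z y ltac:(lra)).
    pose proof (sinh_pos z ltac:(lra)); unfold r; nra.
Qed.

Lemma shc_increment_upper x y :
  0 < x <= y -> shc y - shc x <= shc_slope x * (cosh y - cosh x).
Proof.
  intros Hxy; set (r := shc_slope x).
  assert (r * cosh x - shc x <= r * cosh y - shc y); [|lra].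
  apply (increment_nonneg (fun z => r * cosh z - shc z)
           (fun z => r * sinh z - shc_slope z * sinh z)); [lra| |].
  - intros z Hz; apply is_derive_diff; [|apply is_derive_shc; lra].
    apply is_derive_scal, is_derive_cosh.
  - intros z Hz; pose proof (shc_slope_decreasing x z ltac:(lra)).
    pose proof (sinh_pos z ltac:(lra)); unfold r; nra.
Qed.

(** With [y = n T] and [z = m T], so that [y + z = s] and [y - z = d], this is the
    addition formula applied to [y coth y - z coth z]. *)
Lemma radial_quotient_difference n m T :
  (0 < m < n)%nat -> 0 < T ->
  let s := (INR n + INR m) * T in
  let d := (INR n - INR m) * T in
  T * (radial_quotient n T - radial_quotient m T) * (cosh s - cosh d) =
  s * d * (shc s - shc d).
Proof.
  intros Hmn HT s d.
  assert (Hm : 0 < INR m) by (apply lt_0_INR; lia).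
  assert (Hn : INR m < INR n) by (apply lt_INR; lia).
  unfold radial_quotient, radial_C, radial_S.
  destruct n as [|n]; [lia|]; destruct m as [|m]; [lia|].
  set (N := INR (S n)) in *; set (M' := INR (S m)) in *.
  assert (0 < sinh (N * T)) by (apply sinh_pos, Rmult_lt_0_compat; lra).
  assert (0 < sinh (M' * T)) by (apply sinh_pos, Rmult_lt_0_compat; lra).
  replace s with (N * T + M' * T) by (unfold s; ring).
  replace d with (N * T + - (M' * T)) by (unfold d; ring).
  unfold shc; rewrite !sinh_plus, !cosh_plus, cosh_opp, sinh_opp.
  set (y := N * T) in *; set (z := M' * T) in *.
  assert (0 < z) by (apply Rmult_lt_0_compat; lra).
  assert (z < y) by (apply Rmult_lt_compat_r; lra).
  replace N with (y / T) by (unfold y; field; lra).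
  replace M' with (z / T) by (unfold z; field; lra).
  field; repeat split; lra.
Qed.

(** With [s = (n + m) T] fixed, [(e_n - e_m) / (n - m)] is [s] times a difference
    quotient of [shc] with respect to [cosh] over [[(n - m) T, s]], and those
    quotients decrease as the lower end approaches [s]. *)
Lemma pairing_inequality n m k m0 T :
  (n + m = k + m0)%nat -> (m0 <= m < n)%nat -> 0 < T ->
  (INR n - INR m) * (radial_quotient k T - radial_quotient m0 T) <=
  (INR k - INR m0) * (radial_quotient n T - radial_quotient m T).
Proof.
  intros Hsum Hm HT.
  destruct (Nat.eq_dec m m0) as [->|Hne]; [replace n with k by lia; lra|].
  assert (Hsum' : INR n + INR m = INR k + INR m0) by (rewrite <- !plus_INR; now f_equal).
  assert (Hmn : INR m < INR n) by (apply lt_INR; lia).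
  assert (Hm0m : INR m0 < INR m) by (apply lt_INR; lia).
  pose proof (pos_INR m0) as Hm00.
  pose proof (radial_quotient_difference n m T ltac:(lia) HT) as Enm; simpl in Enm.
  rewrite Hsum' in Enm.
  set (s := (INR k + INR m0) * T) in *; set (d := (INR n - INR m) * T) in *.
  set (d' := (INR k - INR m0) * T).
  assert (Hd : 0 < d) by (apply Rmult_lt_0_compat; lra).
  assert (Hdd' : d < d') by (apply Rmult_lt_compat_r; lra).
  assert (Hd's : d' <= s) by (apply Rmult_le_compat_r; lra).
  pose proof (cosh_lt_nonneg d s ltac:(lra)) as Hch.
  assert (Hr : exists r, T * (radial_quotient k T - radial_quotient m0 T) = s * d' * r /\
                         r * (cosh s - cosh d) <= shc s - shc d).
  { destruct (Nat.eq_dec m0 0) as [->|Hm0].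
    - (* the lower end has reached [s], and the quotient is a derivative *)
      exists (shc_slope s); split; [|apply shc_increment_lower; lra].
      replace d' with s by (unfold s, d'; simpl; ring).
      assert (Hk : (k <> 0)%nat) by lia.
      unfold radial_quotient, radial_C, radial_S, shc_slope.
      destruct k as [|k]; [lia|]; simpl (INR 0) in *; rewrite Rmult_0_l, cosh_0.
      replace s with (INR (S k) * T) in * by (unfold s; ring).
      pose proof (sinh_pos (INR (S k) * T) ltac:(lra)).
      assert (0 < INR (S k)) by (apply lt_0_INR; lia).
      field; lra.
    - pose proof (radial_quotient_difference k m0 T ltac:(lia) HT) as Ek; simpl in Ek.
      fold s d' in Ek.
      assert (Hm0pos : 0 < INR m0) by (apply lt_0_INR; lia).
      assert (Hd's' : d' < s) by (apply Rmult_lt_compat_r; lra).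
      pose proof (cosh_lt_nonneg d' s ltac:(lra)) as Hch'.
      pose proof (cosh_lt_nonneg d d' ltac:(lra)) as Hch''.
      set (r := (shc s - shc d') / (cosh s - cosh d')).
      assert (Er : r * (cosh s - cosh d') = shc s - shc d') by (unfold r; field; lra).
      exists r; split.
      + apply (Rmult_eq_reg_r (cosh s - cosh d')); [|lra].
        rewrite Ek, <- Er; ring.
      + pose proof (shc_increment_upper d' s ltac:(lra)) as U.
        pose proof (shc_increment_lower d d' ltac:(lra)) as L.
        assert (r <= shc_slope d')
          by (apply (Rmult_le_reg_r (cosh s - cosh d')); lra).
        nra. }
  destruct Hr as (r & Er & Hr).
  assert (Hs : 0 < s) by lra.
  assert (L : s * d * r <= T * (radial_quotient n T - radial_quotient m T)).
  { apply (Rmult_le_reg_r (cosh s - cosh d)); [lra|].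
    rewrite Enm, Rmult_assoc; apply Rmult_le_compat_l; auto; nra. }
  apply (Rmult_le_reg_l (T * T)); [nra|].
  replace (T * T * ((INR n - INR m) * (radial_quotient k T - radial_quotient m0 T)))
    with (d * (T * (radial_quotient k T - radial_quotient m0 T))) by (unfold d; ring).
  replace (T * T * ((INR k - INR m0) * (radial_quotient n T - radial_quotient m T)))
    with (d' * (T * (radial_quotient n T - radial_quotient m T))) by (unfold d'; ring).
  rewrite Er.
  replace (d * (s * d' * r)) with (d' * (s * d * r)) by ring.
  apply Rmult_le_compat_l; lra.
Qed.

(** ** Comparison of the roots *)

Lemma lower_root_zero kappa T : 0 < kappa <= 1 -> 0 < T -> char_root kappa T 0 false = 0.
Proof.
  intros Hk HT; rewrite lower_root_formula by auto; simpl; unfold Rdiv; ring.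
Qed.

Lemma lower_root_pos kappa T n :
  0 < kappa <= 1 -> 0 < T -> (0 < n)%nat -> 0 < char_root kappa T n false.
Proof.
  intros Hk HT Hn; rewrite lower_root_formula by auto.
  pose proof (radial_quotient_pos n T HT).
  pose proof (sqrt_pos (radial_quotient n T ^ 2 - kappa * INR n ^ 2)).
  assert (0 < INR n) by (apply lt_0_INR; lia).
  apply Rdiv_lt_0_compat; nra.
Qed.

(** For [n > 0], [n y] is a root of frequency [n] when
    [kappa y^2 / 4 - coth (n T) y + 1 = 0], and [coth] decreases. *)
Lemma lower_root_increasing kappa T m k :
  0 < kappa <= 1 -> 0 < T -> (m < k)%nat ->
  char_root kappa T m false < char_root kappa T k false.
Proof.
  intros Hk HT Hmk.
  pose proof (lower_root_pos kappa T k Hk HT ltac:(lia)) as Hpos.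
  destruct (Nat.eq_dec m 0) as [->|Hm]; [now rewrite lower_root_zero|].
  assert (HmR : 0 < INR m) by (apply lt_0_INR; lia).
  assert (HmkR : INR m < INR k) by (apply lt_INR; lia).
  set (y := char_root kappa T k false / INR k).
  assert (Hy : 0 < y) by (apply Rdiv_lt_0_compat; lra).
  assert (Ey : char_root kappa T k false = INR k * y) by (unfold y; field; lra).
  apply Rlt_trans with (INR m * y); [|rewrite Ey; now apply Rmult_lt_compat_r].
  apply lower_root_lt; auto.
  pose proof (char_root_zero kappa T k Hk HT false) as E.
  rewrite Ey in E; unfold char_poly in *.
  rewrite radial_quotient_scaling in * by (auto; lia).
  assert (Hlt : radial_quotient 1 (INR k * T) < radial_quotient 1 (INR m * T)).
  { apply radial_quotient_decreasing; split; [now apply Rmult_lt_0_compat|].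
    now apply Rmult_lt_compat_r. }
  set (ek := radial_quotient 1 (INR k * T)) in *; set (em := radial_quotient 1 (INR m * T)) in *.
  assert (E' : kappa / 4 * y ^ 2 - ek * y + 1 = 0).
  { apply (Rmult_eq_reg_l (INR k ^ 2)); [|apply pow_nonzero; lra].
    rewrite Rmult_0_r, <- E; ring. }
  replace (kappa / 4 * (INR m * y) ^ 2 - INR m * em * (INR m * y) + INR m ^ 2)
    with (INR m ^ 2 * (kappa / 4 * y ^ 2 - em * y + 1)) by ring.
  assert (0 < INR m ^ 2) by nra.
  assert (0 < (em - ek) * y) by (apply Rmult_lt_0_compat; lra).
  assert (kappa / 4 * y ^ 2 - em * y + 1 < 0) by lra.
  rewrite <- (Rmult_0_r (INR m ^ 2)); now apply Rmult_lt_compat_l.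
Qed.

Lemma lower_root_lt_double kappa T n :
  0 < kappa <= 1 -> 0 < T -> (0 < n)%nat -> char_root kappa T n false < 2 * INR n.
Proof.
  intros Hk HT Hn; apply lower_root_lt; auto.
  pose proof (radial_quotient_gt n T HT).
  assert (0 < INR n) by (apply lt_0_INR; lia).
  unfold char_poly; nra.
Qed.

Lemma radial_double n T :
  radial_C n T = 2 * radial_C n (T / 2) ^ 2 - 1 /\
  radial_S n T = 2 * radial_S n (T / 2) * radial_C n (T / 2).
Proof.
  unfold radial_C, radial_S; split.
  - rewrite <- cosh_double; f_equal; field.
  - destruct n as [|n]; [simpl; rewrite Rmult_0_l, cosh_0; field|].
    replace (INR (S n) * T) with (2 * (INR (S n) * (T / 2))) by field.
    rewrite sinh_double; field; apply not_0_INR; lia.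
Qed.

Lemma char_root_symmetric T n s :
  0 < T -> char_root 1 T n s =
  2 * (radial_quotient n T + (if s then 1 else -1) / radial_S n T).
Proof.
  intros HT; unfold char_root; rewrite Rmult_1_l.
  pose proof (radial_S_pos n T HT).
  replace (radial_quotient n T ^ 2 - INR n ^ 2) with ((/ radial_S n T) ^ 2)
    by (rewrite radial_quotient_sq, pow_inv by auto; ring).
  rewrite sqrt_pow2 by (left; now apply Rinv_0_lt_compat).
  field; lra.
Qed.

Lemma upper_root_symmetric T n :
  0 < T -> char_root 1 T n true = 2 * radial_quotient n (T / 2).
Proof.
  intros HT; rewrite char_root_symmetric by auto; unfold radial_quotient.
  destruct (radial_double n T) as [-> ->].
  pose proof (radial_S_pos n (T / 2) ltac:(lra)).
  assert (0 < radial_C n (T / 2)) by apply cosh_pos.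
  field; lra.
Qed.

Lemma lower_root_symmetric T n :
  0 < T -> char_root 1 T n false = 2 * INR n * tanh (INR n * T / 2).
Proof.
  intros HT; rewrite char_root_symmetric by auto; unfold radial_quotient.
  pose proof (radial_CS n (T / 2)) as E.
  destruct (radial_double n T) as [-> ->].
  pose proof (radial_S_pos n (T / 2) ltac:(lra)).
  assert (HC : 0 < radial_C n (T / 2)) by apply cosh_pos.
  transitivity (2 * INR n ^ 2 * radial_S n (T / 2) / radial_C n (T / 2)).
  - apply (Rmult_eq_reg_r (radial_S n (T / 2) * radial_C n (T / 2))); [|nra].
    transitivity (2 * (radial_C n (T / 2) ^ 2 - 1)); [field; lra|].
    replace (radial_C n (T / 2) ^ 2 - 1) with (INR n ^ 2 * radial_S n (T / 2) ^ 2) by lra.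
    field; lra.
  - unfold tanh, radial_S, radial_C; unfold radial_C in HC.
    replace (INR n * T / 2) with (INR n * (T / 2)) by field.
    destruct n as [|n]; [simpl; unfold Rdiv; ring|].
    field; split; [lra|apply not_0_INR; lia].
Qed.

(** * Extremal metrics *)

Definition wave_pairs (l : list nat) (sel : nat -> nat * bool) : list mode :=
  map (fun i => Wave (fst (sel i)) (snd (sel i)) true) l ++
  map (fun i => Wave (fst (sel i)) (snd (sel i)) false) l.

Lemma wave_pairs_length l sel : length (wave_pairs l sel) = (2 * length l)%nat.
Proof. unfold wave_pairs; rewrite length_app, !length_map; lia. Qed.

Lemma in_wave_pairs l sel x :
  In x (wave_pairs l sel) <->
  exists i q, In i l /\ x = Wave (fst (sel i)) (snd (sel i)) q.
Proof.
  unfold wave_pairs; rewrite in_app_iff, !in_map_iff; split.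
  - intros [(i & <- & Hi)|(i & <- & Hi)]; eauto.
  - intros (i & [|] & Hi & ->); [left|right]; eauto.
Qed.

Lemma wave_pairs_NoDup l sel :
  NoDup l -> (forall i j, In i l -> In j l -> sel i = sel j -> i = j) ->
  NoDup (wave_pairs l sel).
Proof.
  intros Hnd Hinj; unfold wave_pairs.
  assert (Hq : forall q, NoDup (map (fun i => Wave (fst (sel i)) (snd (sel i)) q) l)).
  { intros q; apply NoDup_map_NoDup_ForallPairs; auto.
    intros i j Hi Hj E; injection E as E1 E2; apply Hinj; auto.
    now apply injective_projections. }
  apply NoDup_app; auto.
  intros x; rewrite !in_map_iff; intros (i & <- & _) (j & E & _); discriminate.
Qed.

Definition lower_modes (k : nat) : list mode :=
  Radial false :: wave_pairs (seq 0 k) (fun i => (i, false)).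

Lemma lower_modes_NoDup k : NoDup (lower_modes k).
Proof.
  constructor.
  - rewrite in_wave_pairs; intros (i & q & _ & E); discriminate.
  - apply wave_pairs_NoDup; [apply seq_NoDup|]; intros i j _ _ E; now injection E.
Qed.

Lemma lower_modes_length k : length (lower_modes k) = (2 * k + 1)%nat.
Proof. simpl; rewrite wave_pairs_length, length_seq; lia. Qed.

Lemma lower_modes_le kappa T k x :
  0 < kappa <= 1 -> 0 < T -> In x (lower_modes k) ->
  mode_root kappa T x <= char_root kappa T k false.
Proof.
  intros Hk HT Hx; unfold mode_root.
  assert (Hfb : (frequency x <= k)%nat /\ branch x = false).
  { destruct Hx as [<-|Hx]; [simpl; split; [lia|auto]|].
    apply in_wave_pairs in Hx; destruct Hx as (i & q & Hi & ->).
    apply in_seq in Hi; simpl; split; [lia|auto]. }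
  destruct Hfb as [Hf ->].
  destruct (Nat.eq_dec (frequency x) k) as [->|Hne]; [lra|].
  left; apply lower_root_increasing; auto; lia.
Qed.

(** The critical value [c] and the critical length [Ts], at which for
    [kappa = 1] the lower root of frequency [k] meets the upper root of
    frequency [m0].  The bound [4 k < 3 c] puts the lower roots of every frequency
    up to [(k + m0) / 2] below [c]. *)
Section Extremal.

Variables (k m0 : nat) (c Ts : R).
Hypothesis Hm0 : (m0 <= 1)%nat.
Hypothesis Hm0k : (m0 < k)%nat.
Hypothesis HTs : 0 < Ts.
Hypothesis Hlow : char_root 1 Ts k false = c.
Hypothesis Hup : char_root 1 Ts m0 true = c.
Hypothesis Hc : 4 * INR k < 3 * c.

Let Hone : 0 < 1 <= 1.
Proof. lra. Qed.

Let Hkpos : 0 < INR k.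
Proof. apply lt_0_INR; lia. Qed.

Lemma critical_gap :
  c * (radial_quotient k Ts - radial_quotient m0 Ts) = INR k ^ 2 - INR m0 ^ 2.
Proof.
  pose proof (char_root_zero 1 Ts k Hone HTs false) as E1; rewrite Hlow in E1.
  pose proof (char_root_zero 1 Ts m0 Hone HTs true) as E2; rewrite Hup in E2.
  unfold char_poly in *; lra.
Qed.

(** The characteristic polynomial of frequency [k] at [c] vanishes for [kappa = 1]
    and length [Ts], and it increases with [kappa] and with the length. *)
Lemma short_cylinder kappa T :
  0 < kappa <= 1 -> 0 < T <= Ts -> ~ (kappa = 1 /\ T = Ts) ->
  char_root kappa T k false < c.
Proof.
  intros Hk HT Hne; apply lower_root_lt; [auto|lra|].
  pose proof (char_root_zero 1 Ts k Hone HTs false) as E1; rewrite Hlow in E1.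
  unfold char_poly in *.
  assert (Hcc : 0 < c * c) by nra.
  destruct (Req_dec T Ts) as [->|HTne].
  - assert (kappa < 1) by (destruct Hk as [_ [|]]; tauto).
    assert (kappa * (c * c) < 1 * (c * c)) by (apply Rmult_lt_compat_r; auto).
    lra.
  - pose proof (radial_quotient_decreasing k T Ts ltac:(lra)).
    assert (c * radial_quotient k Ts < c * radial_quotient k T)
      by (apply Rmult_lt_compat_l; lra).
    assert (kappa * (c * c) <= 1 * (c * c)) by (apply Rmult_le_compat_r; lra).
    lra.
Qed.

(** If the lower root of [n] is not below [c], the characteristic polynomial of
    [n] is nonnegative at [c].  That of [m] exceeds it by
    [c (e_n - e_m) - (n^2 - m^2)], which is positive by [pairing_inequality] and
    [critical_gap].  So [c] lies outside the roots of [m], and above them since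
    the lower one is at most [2 m < c]. *)
Lemma long_cylinder_pair kappa T n m :
  0 < kappa <= 1 -> Ts < T -> (n + m = k + m0)%nat -> (m0 <= m < n)%nat ->
  c <= char_root kappa T n false -> char_root kappa T m true < c.
Proof.
  intros Hk HT Hsum Hm Hn.
  assert (HT0 : 0 < T) by lra.
  apply char_poly_nonneg in Hn; auto.
  apply upper_root_lt; auto.
  - pose proof (pairing_inequality n m k m0 T Hsum Hm HT0) as P.
    pose proof (radial_quotient_gap_increasing m0 k Ts T Hm0k ltac:(lra)) as G.
    pose proof critical_gap as E.
    assert (Hsum' : INR n + INR m = INR k + INR m0) by (rewrite <- !plus_INR; now f_equal).
    assert (Hmn : INR m < INR n) by (apply lt_INR; lia).
    assert (HkR : INR m0 < INR k) by (apply lt_INR; lia).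
    set (g := radial_quotient n T - radial_quotient m T) in *.
    set (g0 := radial_quotient k T - radial_quotient m0 T) in *.
    assert (Hg : INR n ^ 2 - INR m ^ 2 < c * g).
    { apply (Rmult_lt_reg_l (INR k - INR m0)); [lra|].
      apply Rlt_le_trans with ((INR n - INR m) * (c * g0)).
      - replace ((INR k - INR m0) * (INR n ^ 2 - INR m ^ 2)) with
          ((INR n - INR m) * ((INR k - INR m0) * (INR n + INR m))) by ring.
        rewrite Hsum'; apply Rmult_lt_compat_l; [lra|].
        replace ((INR k - INR m0) * (INR k + INR m0)) with (INR k ^ 2 - INR m0 ^ 2) by ring.
        rewrite <- E; apply Rmult_lt_compat_l; lra.
      - replace ((INR n - INR m) * (c * g0)) with (c * ((INR n - INR m) * g0)) by ring.
        replace ((INR k - INR m0) * (c * g)) with (c * ((INR k - INR m0) * g)) by ring.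
        apply Rmult_le_compat_l; lra. }
    unfold char_poly in *; unfold g in Hg; lra.
  - destruct (Nat.eq_dec m 0) as [->|Hm0']; [rewrite lower_root_zero by auto; lra|].
    pose proof (lower_root_lt_double kappa T m Hk HT0 ltac:(lia)).
    assert (H6 : (6 * m <= 4 * k)%nat) by lia.
    apply le_INR in H6; rewrite !mult_INR in H6; simpl in H6; lra.
Qed.

(** Of the frequencies [1, ..., k + m0 - 1], those at most [(k + m0) / 2] contribute
    their lower root, and each larger one contributes its lower root or, failing
    that, the upper root of its partner.  The partner of frequency [k] for
    [m0 = 0] is the second radial mode, which counts once. *)
Lemma subcritical_modes kappa T :
  0 < kappa <= 1 -> 0 < T -> ~ (kappa = 1 /\ T = Ts) ->
  exists l, NoDup l /\ (2 * k + m0 <= length l)%nat /\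
            forall x, In x l -> mode_root kappa T x < c.
Proof.
  intros Hk HT Hne.
  destruct (Rlt_le_dec (char_root kappa T k false) c) as [Hlt|Hge].
  - exists (lower_modes k); split; [apply lower_modes_NoDup|].
    split; [rewrite lower_modes_length; lia|].
    intros x Hx; pose proof (lower_modes_le kappa T k x Hk HT Hx); lra.
  - assert (HTT : Ts < T).
    { apply Rnot_le_lt; intros Hle.
      pose proof (short_cylinder kappa T Hk ltac:(lra) Hne); lra. }
    set (N := (k + m0)%nat).
    (* the index [i] stands for the frequency [i + 1] *)
    pose (keep := fun i => (2 * (i + 1) <= N)%nat \/ char_root kappa T (S i) false < c).
    pose (sel := fun i => if excluded_middle_informative (keep i)
                          then (i, false) else ((N - i - 2)%nat, true)).
    exists (Radial false :: (if Nat.eq_dec m0 0 then [Radial true] else []) ++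
            wave_pairs (seq 0 (N - 1)) sel).
    assert (Hnw : forall s, ~ In (Radial s) (wave_pairs (seq 0 (N - 1)) sel)).
    { intros s; rewrite in_wave_pairs; intros (i & q & _ & E); discriminate. }
    split; [|split].
    + assert (Hw : NoDup (wave_pairs (seq 0 (N - 1)) sel)).
      { apply wave_pairs_NoDup; [apply seq_NoDup|].
        intros i j Hi Hj; apply in_seq in Hi, Hj; unfold sel.
        destruct excluded_middle_informative, excluded_middle_informative;
          intros E; injection E; lia || discriminate. }
      constructor; destruct Nat.eq_dec; simpl; auto.
      * intros [E|Hin]; [discriminate|now apply (Hnw false)].
      * constructor; auto.
    + simpl; rewrite length_app, wave_pairs_length, length_seq.
      destruct Nat.eq_dec; simpl; lia.
    + assert (Hzero : mode_root kappa T (Radial false) < c).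
      { unfold mode_root; simpl; rewrite lower_root_zero by auto; lra. }
      intros x [<-|Hx]; auto.
      apply in_app_or in Hx; destruct Hx as [Hx|Hx].
      * destruct (Nat.eq_dec m0 0) as [E0|]; [|destruct Hx].
        destruct Hx as [<-|[]]; unfold mode_root; simpl.
        apply (long_cylinder_pair kappa T k 0); auto; lia.
      * apply in_wave_pairs in Hx; destruct Hx as (i & q & Hi & ->).
        apply in_seq in Hi; unfold mode_root, sel.
        destruct excluded_middle_informative as [[Hs|Hs]|Hs]; 
          simpl fst; simpl snd; simpl frequency; simpl branch; auto.
        -- pose proof (lower_root_lt_double kappa T (S i) Hk HT ltac:(lia)).
           assert (H6 : (6 * S i <= 4 * k)%nat) by lia.
           apply le_INR in H6; rewrite !mult_INR in H6.
           set (r := INR (S i)) in *; simpl in H6; lra.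
        -- unfold keep in Hs.
           apply (long_cylinder_pair kappa T (S i)); auto; try lia.
           apply Rnot_lt_le; tauto.
Qed.

(** For [kappa = 1] both families of roots increase with the frequency, so [c],
    a member of each, bounds the frequencies: less than [k] for lower roots and
    less than [m0] for upper ones. *)
Lemma critical_modes :
  exists l, (length l <= 2 * k + m0 - 1)%nat /\
            forall x, mode_root 1 Ts x < c -> In x l.
Proof.
  exists (Radial false :: (if Nat.eq_dec m0 0 then [] else [Radial true]) ++
          wave_pairs (seq 0 (k - 1)) (fun i => (i, false))); split.
  - simpl; rewrite length_app, wave_pairs_length, length_seq.
    destruct Nat.eq_dec; simpl; lia.
  - intros x Hx; unfold mode_root in Hx.
    destruct (branch x) eqn:Eb.
    + assert (Hj : (frequency x < m0)%nat).
      { destruct (Nat.lt_ge_cases (frequency x) m0) as [|Hge]; auto; exfalso.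
        rewrite <- Hup, !upper_root_symmetric in Hx by auto.
        destruct (Nat.eq_dec (frequency x) m0) as [E|Hne]; [rewrite E in Hx; lra|].
        pose proof (radial_quotient_increasing m0 (frequency x) (Ts / 2) ltac:(lia) ltac:(lra)).
        lra. }
      destruct x as [s|n s q]; simpl in *; [subst s|lia].
      right; destruct Nat.eq_dec; [lia|now left].
    + assert (Hj : (frequency x < k)%nat).
      { destruct (Nat.lt_ge_cases (frequency x) k) as [|Hge]; auto; exfalso.
        rewrite <- Hlow in Hx.
        destruct (Nat.eq_dec (frequency x) k) as [E|Hne]; [rewrite E in Hx; lra|].
        pose proof (lower_root_increasing 1 Ts k (frequency x) Hone HTs ltac:(lia)); lra. }
      destruct x as [s|n s q]; simpl in *; subst s; [now left|right].
      apply in_or_app; right; apply in_wave_pairs; exists n, q; split; auto.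
      apply in_seq; lia.
Qed.

Lemma sigma_tilde_critical T f :
  0 < T -> conformal_factor T f ->
  sigma_tilde f T (2 * k + m0 - 1) <= 2 * PI * c /\
  (sigma_tilde f T (2 * k + m0 - 1) = 2 * PI * c <-> f 0 = f T /\ T = Ts).
Proof.
  intros HT [_ Hf].
  pose proof (boundary_ratio_range f T HT Hf) as Hr.
  pose proof (boundary_ratio_one f T HT Hf) as Hr1.
  destruct (classic (boundary_ratio f T = 1 /\ T = Ts)) as [[E1 E2]|Hne].
  - assert (sigma_tilde f T (2 * k + m0 - 1) = 2 * PI * c); [|rewrite <- Hr1; intuition lra].
    apply Rle_antisym.
    + apply (sigma_tilde_le f T HT Hf c (lower_modes k)).
      * apply lower_modes_NoDup.
      * rewrite lower_modes_length; lia.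
      * intros x Hx; rewrite <- Hlow, E1, E2; now apply lower_modes_le.
    + destruct critical_modes as (l & Hlen & Hl).
      apply (sigma_tilde_ge f T HT Hf c l); auto.
      rewrite E1, E2; auto.
  - destruct (subcritical_modes _ T Hr HT Hne) as (l & Hnd & Hlen & Hl).
    assert (sigma_tilde f T (2 * k + m0 - 1) < 2 * PI * c)
      by (apply (sigma_tilde_lt f T HT Hf c l); auto; lia).
    rewrite <- Hr1; intuition lra.
Qed.

End Extremal.

Lemma conformal_factor_one T : conformal_factor T (fun _ => 1).
Proof.
  split; [|intros; lra].
  exists (fun _ => 1); split; [|auto].
  apply oscillator_smooth; exists (fun _ => 0), 0; split; intros x.
  - apply (is_derive_const (K := R_AbsRing) (V := R_NormedModule)).
  - rewrite Rmult_0_l; apply (is_derive_const (K := R_AbsRing) (V := R_NormedModule)).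
Qed.

Lemma M_attained j v :
  (forall T f, 0 < T -> conformal_factor T f -> sigma_tilde f T j <= v) ->
  (exists T f, 0 < T /\ conformal_factor T f /\ sigma_tilde f T j = v) ->
  M j = Finite v.
Proof.
  intros Hle (T & f & HT & Hf & E); unfold M; apply is_lub_Rbar_unique; split.
  - intros x (T' & f' & HT' & Hf' & ->); now apply Hle.
  - intros b Hb; apply Hb; exists T, f; auto.
Qed.

Lemma extremal_metric k m0 c Ts :
  (m0 <= 1)%nat -> (m0 < k)%nat -> 0 < Ts ->
  char_root 1 Ts k false = c -> char_root 1 Ts m0 true = c -> 4 * INR k < 3 * c ->
  M (2 * k + m0 - 1) = Finite (2 * PI * c) /\
  forall T f, 0 < T -> conformal_factor T f ->
    (Finite (sigma_tilde f T (2 * k + m0 - 1)) = M (2 * k + m0 - 1) <->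
     f 0 = f T /\ T = Ts).
Proof.
  intros Hm0 Hm0k HTs Hlow Hup Hc.
  pose proof (sigma_tilde_critical k m0 c Ts Hm0 Hm0k HTs Hlow Hup Hc) as H.
  assert (E : M (2 * k + m0 - 1) = Finite (2 * PI * c)).
  { apply M_attained; [intros; now apply H|].
    exists Ts, (fun _ => 1); split; auto; split; [apply conformal_factor_one|].
    apply H; auto; apply conformal_factor_one. }
  split; auto; intros T f HT Hf; rewrite E, <- (proj2 (H T f HT Hf)).
  split; [now intros [=]|now intros ->].
Qed.

(** ** The second eigenvalue *)

Lemma sigma_tilde_2_lt T f :
  0 < T -> conformal_factor T f -> sigma_tilde f T 2 < 4 * PI.
Proof.
  intros HT [_ Hf]; pose proof (boundary_ratio_range f T HT Hf) as Hr.
  replace (4 * PI) with (2 * PI * 2) by ring.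
  apply (sigma_tilde_lt f T HT Hf 2 (lower_modes 1)).
  - apply lower_modes_NoDup.
  - rewrite lower_modes_length; lia.
  - intros x Hx.
    pose proof (lower_modes_le _ T 1 x Hr HT Hx).
    pose proof (lower_root_lt_double _ T 1 Hr HT ltac:(lia)) as H1; simpl in H1; lra.
Qed.

(** Only the two radial modes can lie below the first lower root. *)
Lemma sigma_tilde_2_symmetric T f :
  0 < T -> conformal_factor T f -> f 0 = f T ->
  sigma_tilde f T 2 = 4 * PI * tanh (T / 2).
Proof.
  intros HT [_ Hf] Hs; pose proof (boundary_ratio_range f T HT Hf) as Hr.
  pose proof (proj2 (boundary_ratio_one f T HT Hf) Hs) as E1.
  rewrite E1 in Hr.
  assert (E : char_root 1 T 1 false = 2 * tanh (T / 2)).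
  { rewrite lower_root_symmetric by auto; simpl; rewrite Rmult_1_l; ring. }
  replace (4 * PI * tanh (T / 2)) with (2 * PI * (2 * tanh (T / 2))) by ring.
  rewrite <- E; apply Rle_antisym.
  - apply (sigma_tilde_le f T HT Hf _ (lower_modes 1)).
    + apply lower_modes_NoDup.
    + rewrite lower_modes_length; lia.
    + intros x Hx; rewrite E1; now apply lower_modes_le.
  - apply (sigma_tilde_ge f T HT Hf _ [Radial false; Radial true]); [simpl; lia|].
    rewrite E1; intros x Hx; destruct x as [s|n s q]; [destruct s; simpl; auto|exfalso].
    unfold mode_root in Hx; simpl frequency in Hx; simpl branch in Hx.
    pose proof (char_root_ge_lower 1 T (S n) Hr HT s).
    destruct (Nat.eq_dec n 0) as [->|Hn]; [lra|].
    pose proof (lower_root_increasing 1 T 1 (S n) Hr HT ltac:(lia)); lra.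
Qed.

(** ** The critical lengths *)

Lemma tanh_lt_1 x : tanh x < 1.
Proof.
  unfold tanh; apply Rlt_div_l; [apply cosh_pos|].
  unfold sinh, cosh; pose proof (exp_pos (- x)); lra.
Qed.

Lemma one_minus_tanh x : 1 - tanh x = 2 / (exp (2 * x) + 1).
Proof.
  unfold tanh, sinh, cosh; replace (2 * x) with (x + x) by ring.
  rewrite exp_plus, exp_Ropp; pose proof (exp_pos x).
  field; repeat split; nra.
Qed.

Lemma tanh_increasing x y : x < y -> tanh x < tanh y.
Proof.
  intros Hxy; enough (1 - tanh y < 1 - tanh x) by lra.
  rewrite !one_minus_tanh.
  pose proof (exp_pos (2 * x)); pose proof (exp_increasing (2 * x) (2 * y) ltac:(lra)).
  apply Rmult_lt_compat_l; [lra|].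
  apply Rinv_lt_contravar; [|lra]; apply Rmult_lt_0_compat; lra.
Qed.

Lemma tanh_0 : tanh 0 = 0.
Proof. unfold tanh; rewrite sinh_0; unfold Rdiv; ring. Qed.

Lemma tanh_pos x : 0 < x -> 0 < tanh x.
Proof. intros; rewrite <- tanh_0; now apply tanh_increasing. Qed.

Lemma tanh_lt_id x : 0 < x -> tanh x < x.
Proof.
  intros Hx; unfold tanh; apply Rlt_div_l; [apply cosh_pos|].
  assert (0 * cosh 0 - sinh 0 < x * cosh x - sinh x); [|rewrite sinh_0 in *; lra].
  apply (increment_pos (fun y => y * cosh y - sinh y) (fun y => y * sinh y)); auto.
  - intros y _; auto_derive; auto; ring.
  - intros y Hy; apply Rmult_lt_0_compat; [lra|apply sinh_pos; lra].
Qed.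

Lemma continuity_tanh : continuity tanh.
Proof.
  intros x; unfold tanh; apply derivable_continuous_pt, ex_derive_Reals_0.
  auto_derive; pose proof (cosh_pos x); lra.
Qed.

Lemma exp_2_gt_5 : 5 < exp 2.
Proof.
  replace 2 with (1 / 2 + 1 / 2 + (1 / 2 + 1 / 2)) by field.
  rewrite !exp_plus; pose proof (exp_ineq1 (1 / 2) ltac:(lra)) as H.
  set (e := exp (1 / 2)) in *.
  assert (9 / 4 < e * e) by nra; nra.
Qed.

Lemma tanh_gt_two_thirds x : 1 < x -> 2 / 3 < tanh x.
Proof.
  intros Hx; enough (1 - tanh x < 1 / 3) by lra.
  rewrite one_minus_tanh; pose proof exp_2_gt_5.
  pose proof (exp_increasing 2 (2 * x) ltac:(lra)).
  apply Rlt_div_l; lra.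
Qed.

(** The critical equations force [x tanh x >= 1], whence the lower bound on the
    critical value that keeps the low frequencies subcritical. *)
Lemma critical_tanh x : 0 < x -> 1 <= x * tanh x -> 2 / 3 < tanh x.
Proof.
  intros Hx H; apply tanh_gt_two_thirds, Rnot_le_lt; intros Hle.
  pose proof (tanh_lt_1 x); pose proof (tanh_pos x Hx); nra.
Qed.

Lemma coth_tanh x : 0 < x -> coth x * tanh x = 1.
Proof.
  intros Hx; pose proof (sinh_pos x Hx); pose proof (cosh_pos x).
  unfold coth, tanh; field; lra.
Qed.

Lemma eq_coth_iff a x : 0 < x -> a = coth x <-> a * tanh x = 1.
Proof.
  intros Hx; pose proof (tanh_pos x Hx); pose proof (coth_tanh x Hx); split.
  - now intros ->.
  - intros E; apply (Rmult_eq_reg_r (tanh x)); lra.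
Qed.

Lemma unique_level (G : R -> R) b :
  continuity G -> (forall x y, 0 <= x < y -> G x < G y) -> G 0 = 0 ->
  0 < b -> 1 < G b ->
  exists s, 0 < s /\ G s = 1 /\
    forall s', 0 < s' -> G s' = 1 -> s = s'.
Proof.
  intros HG Hinc H0 Hb Hb1.
  destruct (IVT (fun x => G x - 1) 0 b) as (s & Hs & E); try lra.
  { apply continuity_minus; [auto|apply continuity_const; now intros x y]. }
  assert (Hs0 : s <> 0) by (intros ->; lra).
  exists s; split; [lra|split; [lra|]]; intros s' Hs' E'.
  destruct (Rtotal_order s s') as [Hlt|[|Hlt]]; auto; exfalso.
  - specialize (Hinc s s' ltac:(lra)); lra.
  - specialize (Hinc s' s ltac:(lra)); lra.
Qed.

Lemma Rmult_lt_increasing a b a' b' :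
  0 <= a -> 0 <= b -> a < a' -> b < b' -> a * b < a' * b'.
Proof. intros; apply Rmult_le_0_lt_compat; auto. Qed.

Lemma tanh_nonneg x : 0 <= x -> 0 <= tanh x.
Proof. intros [Hx| <-]; [left; now apply tanh_pos|rewrite tanh_0; lra]. Qed.

Lemma critical_length_radial :
  exists s, 0 < s /\ s * tanh s = 1 /\
    forall s', 0 < s' -> s' * tanh s' = 1 -> s = s'.
Proof.
  apply (unique_level (fun s => s * tanh s) 2).
  - apply (continuity_mult (fun s => s)); [|apply continuity_tanh].
    apply derivable_continuous, derivable_id.
  - intros x y Hxy; apply Rmult_lt_increasing; try lra;
      [apply tanh_nonneg; lra|apply tanh_increasing; lra].
  - apply Rmult_0_l.
  - lra.
  - pose proof (tanh_gt_two_thirds 2 ltac:(lra)); lra.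
Qed.

Lemma critical_length_wave k :
  (1 < k)%nat ->
  exists s, 0 < s /\ INR k * tanh (INR k * s / 2) * tanh (s / 2) = 1 /\
    forall s', 0 < s' -> INR k * tanh (INR k * s' / 2) * tanh (s' / 2) = 1 -> s = s'.
Proof.
  intros Hk; assert (Hk2 : 2 <= INR k) by (apply (le_INR 2); lia).
  apply (unique_level (fun s => INR k * tanh (INR k * s / 2) * tanh (s / 2)) 4).
  - assert (Hlin : forall r, continuity (fun s => tanh (r * s / 2))).
    { intros r; apply (continuity_comp (fun s => r * s / 2) tanh); [|apply continuity_tanh].
      intros x; apply derivable_continuous_pt, ex_derive_Reals_0; auto_derive; auto. }
    apply (continuity_mult (fun s => INR k * tanh (INR k * s / 2)) (fun s => tanh (s / 2))).
    + apply (continuity_scal (fun s => tanh (INR k * s / 2))), Hlin.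
    + intros x; specialize (Hlin 1 x).
      replace (fun s => tanh (s / 2)) with (fun s => tanh (1 * s / 2)); auto.
      apply functional_extensionality; intros; now rewrite Rmult_1_l.
  - intros x y Hxy.
    assert (Hkx : 0 <= INR k * x) by (apply Rmult_le_pos; lra).
    assert (Hkxy : INR k * x < INR k * y) by (apply Rmult_lt_compat_l; lra).
    apply Rmult_lt_increasing.
    + apply Rmult_le_pos; [lra|apply tanh_nonneg; lra].
    + apply tanh_nonneg; lra.
    + apply Rmult_lt_compat_l; [lra|apply tanh_increasing; lra].
    + apply tanh_increasing; lra.
  - replace (0 / 2) with 0 by field; rewrite tanh_0; ring.
  - lra.
  - assert (H34 : 3 / 4 < tanh 2).
    { enough (1 - tanh 2 < 1 / 4) by lra.
      rewrite one_minus_tanh; replace (2 * 2) with (2 + 2) by ring; rewrite exp_plus.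
      pose proof exp_2_gt_5; apply Rlt_div_l; nra. }
    replace (4 / 2) with 2 by field.
    assert (tanh 2 < tanh (INR k * 4 / 2)) by (apply tanh_increasing; lra).
    set (u := tanh 2) in *; set (v := tanh (INR k * 4 / 2)) in *.
    assert (9 / 16 < v * u) by nra.
    nra.
Qed.

Lemma radial_extremal_metric k a :
  (1 <= k)%nat -> 0 < a -> a * tanh a = 1 ->
  M (2 * k - 1) = Finite (4 * INR k * PI / a) /\
  forall T f, 0 < T -> conformal_factor T f ->
    (Finite (sigma_tilde f T (2 * k - 1)) = M (2 * k - 1) <->
     f 0 = f T /\ T = 2 / INR k * a).
Proof.
  intros Hk Ha E; assert (HkR : 0 < INR k) by (apply lt_0_INR; lia).
  set (Ts := 2 / INR k * a).
  assert (HTs : 0 < Ts) by (apply Rmult_lt_0_compat; [apply Rdiv_lt_0_compat; lra|auto]).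
  assert (Eth : tanh a = / a) by (apply (Rmult_eq_reg_l a); [rewrite E; field|]; lra).
  replace (4 * INR k * PI / a) with (2 * PI * (2 * INR k / a)) by (field; lra).
  replace (2 * k - 1)%nat with (2 * k + 0 - 1)%nat by lia.
  apply extremal_metric; auto; try lia.
  - rewrite lower_root_symmetric by auto.
    replace (INR k * Ts / 2) with a by (unfold Ts; field; lra).
    rewrite Eth; field; lra.
  - rewrite upper_root_symmetric by auto.
    unfold radial_quotient, radial_C, radial_S; simpl INR; rewrite Rmult_0_l, cosh_0.
    unfold Ts; field; lra.
  - pose proof (critical_tanh a Ha ltac:(lra)); rewrite Eth in *.
    unfold Rdiv; nra.
Qed.

Lemma wave_extremal_metric k s :
  (1 < k)%nat -> 0 < s -> INR k * tanh (INR k * s / 2) * tanh (s / 2) = 1 ->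
  M (2 * k) = Finite (4 * INR k * PI * tanh (INR k * s / 2)) /\
  forall T f, 0 < T -> conformal_factor T f ->
    (Finite (sigma_tilde f T (2 * k)) = M (2 * k) <-> f 0 = f T /\ T = s).
Proof.
  intros Hk Hs E; assert (HkR : 0 < INR k) by (apply lt_0_INR; lia).
  replace (4 * INR k * PI * tanh (INR k * s / 2)) with
    (2 * PI * (2 * INR k * tanh (INR k * s / 2))) by ring.
  replace (2 * k)%nat with (2 * k + 1 - 1)%nat by lia.
  assert (Hks : 0 < INR k * s / 2)
    by (apply Rdiv_lt_0_compat; [now apply Rmult_lt_0_compat|lra]).
  apply extremal_metric; auto.
  - now apply lower_root_symmetric.
  - rewrite upper_root_symmetric by auto.
    apply eq_coth_iff in E; [|lra].
    rewrite Rmult_assoc, E; f_equal.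
    pose proof (sinh_pos (s / 2) ltac:(lra)).
    unfold radial_quotient, radial_C, radial_S, coth; simpl INR; rewrite !Rmult_1_l.
    field; lra.
  - assert (H1 : 1 <= INR k * s / 2 * tanh (INR k * s / 2)).
    { rewrite <- E; pose proof (tanh_lt_id (s / 2) ltac:(lra)).
      pose proof (tanh_pos _ Hks) as Hp.
      replace (INR k * s / 2 * tanh (INR k * s / 2)) with
        (INR k * tanh (INR k * s / 2) * (s / 2)) by field.
      apply Rmult_le_compat_l; [|lra]; apply Rmult_le_pos; lra. }
    pose proof (critical_tanh _ Hks H1); nra.
Qed.

Lemma sigma_tilde_2_limit eps :
  0 < eps ->
  exists T0, forall T f, 0 < T -> T0 < T -> conformal_factor T f -> f 0 = f T ->
    Rabs (sigma_tilde f T 2 - 4 * PI) < eps.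
Proof.
  intros Heps; exists (8 * PI / eps); intros T f HT HT0 Hf Hs.
  rewrite sigma_tilde_2_symmetric by auto.
  pose proof PI_RGT_0; pose proof (tanh_lt_1 (T / 2)).
  replace (4 * PI * tanh (T / 2) - 4 * PI) with (- (4 * PI * (1 - tanh (T / 2)))) by ring.
  rewrite Rabs_Ropp, Rabs_pos_eq by (apply Rmult_le_pos; lra).
  rewrite one_minus_tanh; replace (2 * (T / 2)) with T by field.
  pose proof (exp_ineq1 T ltac:(lra)).
  apply Rlt_div_l in HT0; auto.
  replace (4 * PI * (2 / (exp T + 1))) with (8 * PI / (exp T + 1)) by (field; lra).
  apply Rlt_div_l; [lra|]; nra.
Qed.

Lemma M_2 : M 2 = Finite (4 * PI).
Proof.
  unfold M; apply is_lub_Rbar_unique; split.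
  - intros x (T & f & HT & Hf & ->); left; now apply sigma_tilde_2_lt.
  - intros b Hb.
    assert (H : forall eps, 0 < eps -> Rbar_le (4 * PI - eps) b).
    { intros eps Heps; destruct (sigma_tilde_2_limit eps Heps) as (T0 & H).
      set (T := Rmax 1 (T0 + 1)).
      assert (HT : 0 < T /\ T0 < T)
        by (unfold T; pose proof (Rmax_l 1 (T0 + 1)); pose proof (Rmax_r 1 (T0 + 1)); lra).
      specialize (H T (fun _ => 1) (proj1 HT) (proj2 HT) (conformal_factor_one T) eq_refl).
      apply Rbar_le_trans with (Finite (sigma_tilde (fun _ => 1) T 2)).
      - apply Rabs_def2 in H; simpl; lra.
      - apply Hb; exists T, (fun _ => 1); split; [tauto|]; split; auto.
        apply conformal_factor_one. }
    destruct b as [b| |]; simpl in *; auto.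
    + apply le_epsilon; intros eps Heps; specialize (H eps Heps); lra.
    + apply (H 1); lra.
Qed.

Theorem theorem1p1 :
  exists (T20 : R) (Tk1 : nat -> R),
    unique (fun s => 0 < s /\ s = coth s) T20 /\
    (forall k : nat, (1 < k)%nat ->
       unique (fun s => 0 < s /\ INR k * tanh (INR k * s / 2) = coth (s / 2))
              (Tk1 k)) /\
    (forall k : nat, (1 <= k)%nat ->
       M (2 * k - 1) = Finite (4 * INR k * PI / T20) /\
       forall (T : R) (f : R -> R), 0 < T -> conformal_factor T f ->
         (Finite (sigma_tilde f T (2 * k - 1)) = M (2 * k - 1) <->
          f 0 = f T /\ T = 2 / INR k * T20)) /\
    (M 2 = Finite (4 * PI) /\
     forall eps : R, 0 < eps ->
       exists T0 : R, forall (T : R) (f : R -> R),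
         0 < T -> T0 < T -> conformal_factor T f -> f 0 = f T ->
         Rabs (sigma_tilde f T 2 - 4 * PI) < eps) /\
    (forall k : nat, (1 < k)%nat ->
       M (2 * k) = Finite (4 * INR k * PI * tanh (INR k * Tk1 k / 2)) /\
       forall (T : R) (f : R -> R), 0 < T -> conformal_factor T f ->
         (Finite (sigma_tilde f T (2 * k)) = M (2 * k) <->
          f 0 = f T /\ T = Tk1 k)).
Proof.
  destruct critical_length_radial as (T20 & H20 & E20 & U20).
  assert (Hex : forall k, exists s, (1 < k)%nat ->
    0 < s /\ INR k * tanh (INR k * s / 2) * tanh (s / 2) = 1 /\
    forall s', 0 < s' -> INR k * tanh (INR k * s' / 2) * tanh (s' / 2) = 1 -> s = s').
  { intros k; destruct (Nat.lt_ge_cases 1 k) as [Hk|Hk].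
    - destruct (critical_length_wave k Hk) as (s & Hs); now exists s.
    - exists 0; lia. }
  apply choice_function in Hex; destruct Hex as (Tk1 & HTk1).
  exists T20, Tk1; split; [|split; [|split; [|split; [split|]]]].
  - split; [split; auto; now apply eq_coth_iff|].
    intros s [Hs E]; apply U20; auto; now apply eq_coth_iff.
  - intros k Hk; destruct (HTk1 k Hk) as (Hs & E & U).
    split; [split; auto; apply eq_coth_iff; auto; lra|].
    intros s [Hs' E']; apply U; auto; apply eq_coth_iff in E'; auto; lra.
  - intros k Hk; now apply radial_extremal_metric.
  - exact M_2.
  - exact sigma_tilde_2_limit.
  - intros k Hk; destruct (HTk1 k Hk) as (Hs & E & _); now apply wave_extremal_metric.
Qed.
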